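(* For all integers $n\ge1$ we have $$CS(n,x)=P_n\left(\frac{x-1}{2}\right)$$ as polynomials in $x$.
   Context: Work in the regular triangular lattice with unit side. A lozenge is a unit rhombus that is the union of two unit triangles of the lattice sharing an edge; a lozenge tiling of a region (a finite union of unit triangles) is a covering of it by lozenges contained in it, without gaps or overlaps. For integers $n\ge1$, $x\ge0$, $H_{n,x}$ is obtained as follows. Take the lattice hexagon with all angles $120^\circ$ and side lengths $n,n+x,n,n+x,n,n+x$ in cyclic order, and remove from its center the triangular lattice region of side $x$ whose vertices point towards the shorter sides (those of length $n$) of the hexagon. (Equivalently: take a lattice equilateral triangle of side $3n+x$, cut off the three corner triangles of side $n$, and remove the concentric triangle of side $x$ with the same orientation as the large triangle.) $CS(n,x)$ is the number of lozenge tilings of $H_{n,x}$ invariant under rotation by $120^\circ$ around its center. For fixed $n$ it is given, for all integers $x\ge0$, by the polynomial in $x$ $$\det\left(\delta_{ij}+\binom{x+i+j}{i}\right)_{0\le i,j\le n-1},$$ and $CS(n,x)$ also denotes this polynomial. The polynomials $P_m$ ($m\ge1$) are defined as follows, with $(a)_k:=a(a+1)\cdots(a+k-1)$, $(a)_0=1$. For $n\ge1$, $P_{2n}$ and $P_{2n-1}$ are the polynomials in $x$ which for all integers $x\ge1$ are given by $$P_{2n}(x)=\frac{n!\,(x-1)!}{(2n)!}\left(\prod_{i=0}^{n}\frac{(x+2i)_{i+1}}{(x+n+i)!}\right)\prod_{i=0}^{n-1}\frac{[i!]^2\,[(2x+2i+2)_{i+1}]^2\,(x+i)!\,(x+2i+1)_i}{[(2i)!]^2},$$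 $$P_{2n-1}(x)=\frac{(x-1)!\,(2x+2n)_n}{(x+n-1)!}\prod_{i=0}^{n-1}\frac{[i!]^2\,[(2x+2i)_{i}]^2\,(x+i)!\,(x+2i)_{i+1}\,(x+2i+1)_i}{[(2i)!]^2\,(x+n+i)!}.$$ (For fixed $n$ these expressions are polynomial functions of $x$.) *)

(* Defs.v *)
From mathcomp Require Import all_boot all_order all_algebra.
From mathcomp Require classical_sets.
Set Implicit Arguments.
Unset Strict Implicit.
Unset Printing Implicit Defensive.
Import GRing.Theory.

Local Open Scope ring_scope.

(* A lattice equilateral triangle of side N is put in barycentric coordinates
   (a_0, a_1, a_2), a_k >= 0, a_0 + a_1 + a_2 = N.  The lattice lines are the
   lines a_k = constant, so the three integers |_ a_k _| determine a unit
   triangle inside it; their sum is N - 1 if the unit triangle has the same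
   orientation as the large one ("up"), and N - 2 otherwise ("down").         *)
Definition cell (N : nat) := {ffun 'I_3 -> 'I_N}.

Definition is_up (N : nat) (t : cell N) : bool :=
  ((\sum_(k < 3) t k).+1 == N)%N.

Definition is_down (N : nat) (t : cell N) : bool :=
  ((\sum_(k < 3) t k).+2 == N)%N.

Definition triangle (N : nat) : {set cell N} :=
  [set t | is_up t || is_down t].

(* The vertices of the up triangle s are s + e_0, s + e_1, s + e_2, and those
   of the down triangle t are t + e_1 + e_2, t + e_0 + e_2, t + e_0 + e_1; they
   have two vertices in common exactly when s = t + e_k for some k, i.e. (the
   coordinate sums differing by 1) when t <= s coordinatewise.                *)
Definition share_edge (N : nat) (s t : cell N) : bool :=
  [&& is_up s, is_down t & [forall k, (t k <= s k)%N]].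

Definition is_lozenge (N : nat) (L : {set cell N}) : bool :=
  [exists s, exists t, share_edge s t && (L == [set s; t])].

Definition is_tiling (N : nat) (A : {set cell N}) (T : {set {set cell N}}) :
    bool :=
  partition T A && [forall L in T, is_lozenge L].

(* Cyclic shift of the coordinates: the rotation by 120 degrees around the
   center of the large triangle.                                              *)
Definition rot120 (N : nat) (t : cell N) : cell N := [ffun k => t (ordS k)].

Definition rot_invariant (N : nat) (T : {set {set cell N}}) : bool :=
  [set @rot120 N @: L | L : {set cell N} in T] == T.

(* In the triangle of side 3n+x, the corner triangle of side n at the k-th
   vertex is a_k >= 2n+x, and the concentric triangle of side x with the same
   orientation is given by a_0, a_1, a_2 >= n.                                *)
Definition corner (n x : nat) (k : 'I_3) : {set cell (3 * n + x)} :=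
  [set t in triangle (3 * n + x) | (2 * n + x <= t k)%N].

Definition core (n x : nat) : {set cell (3 * n + x)} :=
  [set t in triangle (3 * n + x) | [forall k, (n <= t k)%N]].

Definition H (n x : nat) : {set cell (3 * n + x)} :=
  triangle (3 * n + x) :\: ((\bigcup_(k < 3) corner n x k) :|: core n x).

Definition num_cs_tilings (n x : nat) : nat :=
  #|[set T : {set {set cell (3 * n + x)}}
      | is_tiling (H n x) T && rot_invariant T]|.

(* CS n and P m are determined by their values, as a polynomial over rat is
   determined by its values at infinitely many points.  The default values 1
   and 0 of xget, returned should no such polynomial exist, are different so
   that CS n cannot coincide with a transform of P n merely by default.       *)
Definition CS (n : nat) : {poly rat} :=
  classical_sets.xget 1 (fun p : {poly rat} =>
            forall x : nat, p.[x%:R] = (num_cs_tilings n x)%:R).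

Definition rising (a k : nat) : nat := (\prod_(j < k) (a + j))%N.

Definition P_even_value (n x : nat) : rat :=
  (n`! * x.-1`!)%:R / ((2 * n)`!)%:R
  * (\prod_(i < n.+1) ((rising (x + 2 * i) i.+1)%:R / ((x + n + i)`!)%:R))
  * \prod_(i < n)
      ((i`! ^ 2 * rising (2 * x + 2 * i + 2) i.+1 ^ 2 * (x + i)`!
        * rising (x + 2 * i + 1) i)%:R
       / ((2 * i)`! ^ 2)%:R).

Definition P_odd_value (n x : nat) : rat :=
  (x.-1`! * rising (2 * x + 2 * n) n)%:R / ((x + n - 1)`!)%:R
  * \prod_(i < n)
      ((i`! ^ 2 * rising (2 * x + 2 * i) i ^ 2 * (x + i)`!
        * rising (x + 2 * i) i.+1 * rising (x + 2 * i + 1) i)%:R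
       / ((2 * i)`! ^ 2 * (x + n + i)`!)%:R).

(* m = 2n - 1 if m is odd, with n = uphalf m, and m = 2n otherwise. *)
Definition P_value (m x : nat) : rat :=
  if odd m then P_odd_value (uphalf m) x else P_even_value m./2 x.

Definition P (m : nat) : {poly rat} :=
  classical_sets.xget 0 (fun p : {poly rat} =>
            forall x : nat, (1 <= x)%N -> p.[x%:R] = P_value m x).

(* Main.v *)
Require Import Defs.
From mathcomp Require Import all_boot all_order all_algebra all_fingroup.
From mathcomp Require Import zify ring.

(** The three regions a_k < n <= a_{k+1} of H_{n,x} are permuted by the rotation,
    so a symmetric tiling is a matching of the n (n + x) down triangles of one of
    them with the orbits of up triangles: a permutation all of whose moves are
    steps of a graph.  Its nontrivial cycles are non-crossing lattice paths, each
    closed up by one passage to the next region, which determines the sign of the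
    permutation and turns the count into a determinant; inverting the part of the
    matrix without the passages reduces it to det(delta_ij + C(x+i+j, i)).

    For x replaced by 2x+1 this matrix is 1 + A B with A and B two incarnations of
    the involution p(X) |-> p(1-X).  In bases of eigenvectors, built from powers of
    X (X-1) times 1 or 2X-1, it splits by parity into two determinants of the form
    det((x+y+i+j-1)! / ((x+2i-j)! (y+2j-i)!)), which are evaluated by Dodgson
    condensation. *)

Set Implicit Arguments.
Unset Strict Implicit.
Unset Printing Implicit Defensive.
Import GRing.Theory.

(** No signs survive because forward steps get weight -1, while passages to the next region and
    fixed triangles get +1: a cycle of length L has sign (-1)^(L-1) and, with exactly one passage, L
    - 1 forward steps. Arguments 2x+1 suffice because infinitely many values determine a polynomial.
    If a row f and a column e are eigenvectors of A and B, then f (1 + A B) e is f e times 1 plus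
    the product of the eigenvalues, so either 2 f e or 0; this is the splitting by parity. The
    resulting 2^n cancels against leading coefficients: for each r, exactly one of row r and column
    r carries the factor 2X-1. That the formulas for P_n are polynomial in x is not presupposed; it
    comes out of the evaluation. *)

Notation o0 := (@Ordinal 3 0 isT).
Notation o1 := (@Ordinal 3 1 isT).
Notation o2 := (@Ordinal 3 2 isT).

Lemma ord3P (k : 'I_3) : [\/ k = o0, k = o1 | k = o2].
Proof.
by case: k => [[|[|[|//]]]] h;
  [apply: Or31 | apply: Or32 | apply: Or33]; apply: val_inj.
Qed.

Lemma forall_ord3 (p : pred 'I_3) :
  [forall k, p k] = [&& p o0, p o1 & p o2].
Proof.
apply/forallP/and3P => [pk | [p0 p1 p2] k]; first by split; apply: pk.
by case: (ord3P k) => ->.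
Qed.

Lemma ordS3 : (ordS o0 = o1) * (ordS o1 = o2) * (ordS o2 = o0).
Proof. by do !split; apply: val_inj. Qed.

Lemma ord3E : ((o0 == o0 = true) * (o0 == o1 = false) * (o0 == o2 = false))
  * ((o1 == o0 = false) * (o1 == o1 = true) * (o1 == o2 = false))
  * ((o2 == o0 = false) * (o2 == o1 = false) * (o2 == o2 = true)).
Proof. by do !split. Qed.

(** * Unit triangles and lozenges *)

Section Cells.

Variable N : nat.
Implicit Types s t : cell N.

Lemma sum_cell t : \sum_(k < 3) t k = t o0 + t o1 + t o2.
Proof.
rewrite !big_ord_recr big_ord0 /= add0n.
by congr (_ + _ + _); congr (nat_of_ord (t _)); apply: val_inj.
Qed.

Lemma cell_ext s t :
  s o0 = t o0 :> nat -> s o1 = t o1 :> nat -> s o2 = t o2 :> nat -> s = t.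
Proof.
by move=> e0 e1 e2; apply/ffunP=> k; apply: val_inj; case: (ord3P k) => ->.
Qed.

Lemma cell_coord s t : s = t ->
  [/\ s o0 = t o0 :> nat, s o1 = t o1 :> nat & s o2 = t o2 :> nat].
Proof. by move->. Qed.

Lemma rot120E t :
  (rot120 t o0 = t o1) * (rot120 t o1 = t o2) * (rot120 t o2 = t o0).
Proof. by rewrite !ffunE !ordS3. Qed.

Lemma rot120_inj : injective (@rot120 N).
Proof.
move=> s t e; have eqc k : rot120 s k = rot120 t k by rewrite e.
by apply: cell_ext; [have := eqc o2 | have := eqc o0 | have := eqc o1];
  rewrite !rot120E => ->.
Qed.

Lemma rot120_3 t : rot120 (rot120 (rot120 t)) = t.
Proof. by apply: cell_ext; rewrite !rot120E. Qed.

Lemma iter_rot120_mod r t : iter r (@rot120 N) t = iter (r %% 3) (@rot120 N) t.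
Proof.
rewrite {1}(divn_eq r 3) addnC iterD; congr iter.
by elim: (r %/ 3) => [|m IH] //; rewrite mulSn iterD IH /= rot120_3.
Qed.

Lemma iter_rot120_inj r : injective (iter r (@rot120 N)).
Proof. by elim: r => // r IH s t /rot120_inj/IH. Qed.

Lemma iter_rot120K r t : iter r (@rot120 N) (iter (2 * r) (@rot120 N) t) = t.
Proof. by rewrite -iterD iter_rot120_mod -mulSn mulnC modnMl. Qed.

Lemma is_upE t : is_up t = ((t o0 + t o1 + t o2).+1 == N).
Proof. by rewrite /is_up sum_cell. Qed.

Lemma is_downE t : is_down t = ((t o0 + t o1 + t o2).+2 == N).
Proof. by rewrite /is_down sum_cell. Qed.

Lemma rot120_up t : is_up (rot120 t) = is_up t.
Proof. by rewrite !is_upE !rot120E addnC addnA. Qed.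

Lemma rot120_down t : is_down (rot120 t) = is_down t.
Proof. by rewrite !is_downE !rot120E addnC addnA. Qed.

Lemma iter_rot120_up r t : is_up (iter r (@rot120 N) t) = is_up t.
Proof. by elim: r => //= r IH; rewrite rot120_up. Qed.

Lemma iter_rot120_down r t : is_down (iter r (@rot120 N) t) = is_down t.
Proof. by elim: r => //= r IH; rewrite rot120_down. Qed.

Lemma up_not_down t : is_up t -> is_down t = false.
Proof. by rewrite is_upE is_downE; lia. Qed.

(* Reduction mod N only serves to make the map total. *)
Definition cell_of (N_gt0 : 0 < N) (a b c : nat) : cell N :=
  [ffun k : 'I_3 => Ordinal (ltn_pmod (nth 0 [:: a; b; c] k) N_gt0)].

Lemma cell_ofE (N_gt0 : 0 < N) a b c : a + b + c < N ->
  (cell_of N_gt0 a b c o0 = a :> nat) * (cell_of N_gt0 a b c o1 = b :> nat)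
  * (cell_of N_gt0 a b c o2 = c :> nat).
Proof. by move=> h; rewrite !ffunE /= !modn_small //; lia. Qed.

Definition shift (N_gt0 : 0 < N) t (k : 'I_3) : cell N :=
  cell_of N_gt0 (t o0 + (k == o0)) (t o1 + (k == o1)) (t o2 + (k == o2)).

Lemma shiftE (N_gt0 : 0 < N) t k : is_down t ->
  (shift N_gt0 t k o0 = t o0 + (k == o0) :> nat)
  * (shift N_gt0 t k o1 = t o1 + (k == o1) :> nat)
  * (shift N_gt0 t k o2 = t o2 + (k == o2) :> nat).
Proof.
rewrite is_downE => h; apply: cell_ofE.
by case: (ord3P k) => ->; rewrite ?ord3E /=; lia.
Qed.

Lemma share_edge_rot120 s t : share_edge (rot120 s) (rot120 t) = share_edge s t.
Proof.
rewrite /share_edge rot120_up rot120_down !forall_ord3 !rot120E.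
by case: (is_up s) => //; case: (is_down t) => //=; lia.
Qed.

Lemma iter_rot120_edge r s t :
  share_edge (iter r (@rot120 N) s) (iter r (@rot120 N) t) = share_edge s t.
Proof. by elim: r => //= r IH; rewrite share_edge_rot120. Qed.

Lemma share_edgeP (N_gt0 : 0 < N) s t :
  reflect (is_down t /\ exists k, s = shift N_gt0 t k) (share_edge s t).
Proof.
rewrite /share_edge forall_ord3; apply: (iffP and3P).
  case=> us dt /and3P[l0 l1 l2]; split=> //.
  move: us dt (dt); rewrite is_upE {1}is_downE => us dt' dt.
  have: [\/ s o0 = (t o0).+1 :> nat /\ (s o1 = t o1 :> nat /\ s o2 = t o2 :> nat),
    s o1 = (t o1).+1 :> nat /\ (s o0 = t o0 :> nat /\ s o2 = t o2 :> nat) |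
    s o2 = (t o2).+1 :> nat /\ (s o0 = t o0 :> nat /\ s o1 = t o1 :> nat)].
    case: (ltnP (t o0) (s o0)) => h0; first by apply: Or31; lia.
    case: (ltnP (t o1) (s o1)) => h1; first by apply: Or32; lia.
    by apply: Or33; lia.
  by case=> -[? [? ?]]; [exists o0 | exists o1 | exists o2];
    apply: cell_ext; rewrite shiftE // ?ord3E /=; lia.
case=> dt [k ->]; move: (dt); rewrite is_upE !shiftE // is_downE => h.
by case: (ord3P k) => ->; rewrite ?ord3E /=; split=> //; lia.
Qed.

Lemma shift_up (N_gt0 : 0 < N) t k : is_down t -> is_up (shift N_gt0 t k).
Proof.
move=> dt; suff /and3P[] : share_edge (shift N_gt0 t k) t by [].
by apply/(share_edgeP N_gt0); split=> //; exists k.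
Qed.

Lemma shift_inj (N_gt0 : 0 < N) t : is_down t -> injective (shift N_gt0 t).
Proof.
move=> dt k l e.
case/cell_coord: e; rewrite !shiftE //.
case: (ord3P k) => ->; case: (ord3P l) => -> //=; try lia.
Qed.

End Cells.
(** * Symmetric tilings as steps on a fundamental domain *)

Section Grid.

Variables n x : nat.
Implicit Types i j : 'I_(n * (n + x)).
Implicit Types t : cell (3 * n + x).

(** The region a_0 < n <= a_1 of H_{n,x} is an n by (n + x) array in the coordinates a_0 and a_1 -
    n. A row-major number stands both for a down triangle and for an up triangle. *)
Definition grid_row i : nat := i %/ (n + x).
Definition grid_col i : nat := i %% (n + x).

Lemma width_gt0 i : 0 < n + x.
Proof. by case: i; case: (n + x) => // m; rewrite muln0. Qed.

Lemma grid_row_lt i : grid_row i < n.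
Proof. by rewrite /grid_row ltn_divLR ?(width_gt0 i). Qed.

Lemma grid_col_lt i : grid_col i < n + x.
Proof. by rewrite /grid_col ltn_mod (width_gt0 i). Qed.

Lemma grid_ext i j : grid_row i = grid_row j -> grid_col i = grid_col j -> i = j.
Proof.
rewrite /grid_row /grid_col => ep eq; apply: val_inj.
by rewrite /= (divn_eq i (n + x)) ep eq -divn_eq.
Qed.

Lemma grid_ex p q : p < n -> q < n + x ->
  exists i, grid_row i = p /\ grid_col i = q.
Proof.
move=> hp hq.
have h : p * (n + x) + q < n * (n + x).
  by rewrite (leq_trans (n := p.+1 * (n + x))) ?leq_mul2r ?hp ?orbT // mulSnr ltn_add2l.
exists (Ordinal h); rewrite /grid_row /grid_col /= divnMDl ?(leq_trans _ hq) //.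
by rewrite divn_small // addn0 modnMDl modn_small.
Qed.

(* step i k j says that the up triangle s = t + e_k, where t is the down
   triangle number i, lies in the orbit of the up triangle number j.  A step
   along e_0 from the last row leaves the fundamental domain and reenters it
   through its first column.                                                *)
Definition step i (k : 'I_3) j : bool :=
  match nat_of_ord k with
  | 0 => [&& grid_row j == (grid_row i).+1 & grid_col j == grid_col i]
         || [&& (grid_row i).+1 == n, grid_col j == 0 & grid_row j + grid_col i + 1 == n + x]
  | 1 => [&& grid_row j == grid_row i & grid_col j == (grid_col i).+1]
  | _ => j == i
  end.

(** By [step_fun] the permutation is determined by f, so a sum over all permutations counts each
    such f once. *)
Definition valid_steps (f : {ffun 'I_(n * (n + x)) -> 'I_3}) : bool :=
  [exists s : {perm 'I_(n * (n + x))}, [forall i, step i (f i) (s i)]].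

Lemma step_fun i k j j' : step i k j -> step i k j' -> j = j'.
Proof.
have := (grid_row_lt i, grid_row_lt j, grid_row_lt j', grid_col_lt i) => -[[[]]].
by case: (ord3P k) => -> /=; rewrite /step /=; last
  (by move=> _ _ _ _ /eqP -> /eqP ->); move=> *; apply: grid_ext; lia.
Qed.

Hypothesis n_gt0 : 0 < n.

(** * The fundamental region and its rotated copies *)

Lemma side_gt0 : 0 < 3 * n + x. Proof. by lia. Qed.

Let rot := @rot120 (3 * n + x).

Definition up_cell i : cell (3 * n + x) :=
  cell_of side_gt0 (grid_row i) (grid_col i + n) (2 * n + x - 1 - grid_row i - grid_col i).

Definition down_cell i : cell (3 * n + x) :=
  cell_of side_gt0 (grid_row i) (grid_col i + n) (2 * n + x - 2 - grid_row i - grid_col i).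

Definition nbr i k := shift side_gt0 (down_cell i) k.

Lemma up_cellE i :
  (up_cell i o0 = grid_row i :> nat) * (up_cell i o1 = grid_col i + n :> nat)
  * (up_cell i o2 = 2 * n + x - 1 - grid_row i - grid_col i :> nat).
Proof. by apply: cell_ofE; have := grid_row_lt i; have := grid_col_lt i; lia. Qed.

Lemma down_cellE i :
  (down_cell i o0 = grid_row i :> nat) * (down_cell i o1 = grid_col i + n :> nat)
  * (down_cell i o2 = 2 * n + x - 2 - grid_row i - grid_col i :> nat).
Proof. by apply: cell_ofE; have := grid_row_lt i; have := grid_col_lt i; lia. Qed.

Lemma up_cell_up i : is_up (up_cell i).
Proof.
by rewrite is_upE !up_cellE; have := grid_row_lt i; have := grid_col_lt i; lia.
Qed.

Lemma down_cell_down i : is_down (down_cell i).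
Proof.
by rewrite is_downE !down_cellE; have := grid_row_lt i; have := grid_col_lt i; lia.
Qed.

Lemma in_H t : (t \in H n x) =
  [&& is_up t || is_down t, t o0 < 2 * n + x, t o1 < 2 * n + x, t o2 < 2 * n + x
    & ~~ [&& n <= t o0, n <= t o1 & n <= t o2]].
Proof.
rewrite in_setD in_setU.
have -> : (t \in \bigcup_(k < 3) corner n x k) =
    (t \in triangle (3 * n + x)) && ~~ [&& t o0 < 2 * n + x, t o1 < 2 * n + x
      & t o2 < 2 * n + x].
  rewrite -(forall_ord3 (fun k => t k < 2 * n + x)) negb_forall.
  apply/bigcupP/andP => [[k _] | [tT /existsP[k]]].
    rewrite inE => /andP[-> h]; split=> //.
    by apply/existsP; exists k; rewrite -leqNgt.
  by rewrite -leqNgt => h; exists k; rewrite // inE tT.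
rewrite !inE forall_ord3; case: (is_up t || is_down t) => //=.
by rewrite ?andbT negb_or negbK -!andbA.
Qed.

Lemma rot120_H t : (rot t \in H n x) = (t \in H n x).
Proof.
rewrite !in_H /rot rot120_up rot120_down !rot120E.
by case: (is_up t || is_down t) => //=; lia.
Qed.

Lemma iter_rot120_H r t : (iter r rot t \in H n x) = (t \in H n x).
Proof. by elim: r => //= r IH; rewrite rot120_H. Qed.

Lemma up_cell_H i : up_cell i \in H n x.
Proof.
rewrite in_H up_cell_up !up_cellE.
by have := grid_row_lt i; have := grid_col_lt i; lia.
Qed.

Lemma down_cell_H i : down_cell i \in H n x.
Proof.
rewrite in_H down_cell_down orbT !down_cellE.
by have := grid_row_lt i; have := grid_col_lt i; lia.
Qed.

(** The coordinate sum forbids all a_k < n, and the missing core forbids all a_k >= n. So somewhere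
    in cyclic order a_k < n <= a_{k+1}, and a rotation brings this pair to the front. *)
Lemma in_H_rot t : t \in H n x ->
  exists r i, t = iter r rot (if is_up t then up_cell i else down_cell i).
Proof.
have key (u : cell (3 * n + x)) : u \in H n x -> u o0 < n -> n <= u o1 ->
    exists i, u = if is_up u then up_cell i else down_cell i.
  rewrite in_H => /and5P[uT u0 u1 u2 _] h0 h1.
  have [i [ri ci]] := @grid_ex (u o0) (u o1 - n) h0 ltac:(lia).
  exists i; case: ifP uT => [|_] /=.
    rewrite is_upE => /eqP e _.
    by apply: cell_ext; rewrite !up_cellE ?ri ?ci //; lia.
  rewrite is_downE => /eqP e.
  by apply: cell_ext; rewrite !down_cellE ?ri ?ci //; lia.
move=> tH.
have [h|[h|h]] : (t o0 < n <= t o1) \/ (t o1 < n <= t o2) \/ (t o2 < n <= t o0).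
- by move: tH; rewrite in_H is_upE is_downE; lia.
- by have [h0 h1] := andP h; have [i e] := key t tH h0 h1; exists 0, i.
- have [i e] : exists i, rot t = if is_up (rot t) then up_cell i else down_cell i.
    by apply: key; rewrite ?rot120_H /rot ?rot120E //; lia.
  by exists 2, i; rewrite /= -(rot120_up t) -e /rot rot120_3.
- have [i e] : exists i, rot (rot t) =
      if is_up (rot (rot t)) then up_cell i else down_cell i.
    by apply: key; rewrite ?rot120_H /rot ?rot120E //; lia.
  by exists 1, i; rewrite /= -(rot120_up t) -(rot120_up (rot t)) -e /rot rot120_3.
Qed.

(** Any two of the three cyclic pairs are adjacent, so a_k < n <= a_{k+1} holds for at most one k:
    the rotated copies are disjoint. *)
Lemma iter_rot_fundamental r r' t t' :
    t o0 < n <= t o1 -> t' o0 < n <= t' o1 -> t \in H n x ->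
  iter r rot t = iter r' rot t' -> t = t' /\ r = r' %[mod 3].
Proof.
rewrite (iter_rot120_mod r) (iter_rot120_mod r') => ht ht' tH.
have [-> e|] := eqVneq (r %% 3) (r' %% 3).
  by split=> //; elim: (r' %% 3) e => //= m IH /rot120_inj.
move: (ltn_pmod r (isT : 0 < 3)) (ltn_pmod r' (isT : 0 < 3)).
case: (r %% 3) => [|[|[|//]]] _; case: (r' %% 3) => [|[|[|//]]] _ //= _ e;
  case/cell_coord: e; rewrite /rot !rot120E => e0 e1 e2;
  by move: ht ht' tH; rewrite in_H; lia.
Qed.

Lemma up_cell_inj r r' i i' :
  iter r rot (up_cell i) = iter r' rot (up_cell i') ->
  i = i' /\ r = r' %[mod 3].
Proof.
have [h h'] := (grid_row_lt i, grid_row_lt i').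
case/iter_rot_fundamental => [|||e ->]; rewrite ?up_cellE ?up_cell_H //; try lia.
by case/cell_coord: e; rewrite !up_cellE => *; split=> //; apply: grid_ext; lia.
Qed.

Lemma down_cell_inj r r' i i' :
  iter r rot (down_cell i) = iter r' rot (down_cell i') ->
  i = i' /\ r = r' %[mod 3].
Proof.
have [h h'] := (grid_row_lt i, grid_row_lt i').
case/iter_rot_fundamental => [|||e ->]; rewrite ?down_cellE ?down_cell_H //; try lia.
by case/cell_coord: e; rewrite !down_cellE => *; split=> //; apply: grid_ext; lia.
Qed.

Definition wraps i (k : 'I_3) : bool := (k == o0) && ((grid_row i).+1 == n).

(** Only a step across a_0 = n leaves the region, and it costs one rotation; the boolean is used as
    the number of rotations. *)
Lemma nbr_step i k j : step i k j -> nbr i k = iter (wraps i k) rot (up_cell j).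
Proof.
have := (grid_row_lt i, grid_row_lt j, grid_col_lt i, grid_col_lt j) => -[[[]]].
rewrite /wraps; case: (ord3P k) => -> hi hj ci cj; rewrite /step /= ?ord3E /=.
- case: (eqVneq (grid_row i).+1 n) => e /= h;
    apply: cell_ext; rewrite /nbr /rot ?rot120E shiftE ?down_cell_down // ?up_cellE
      ?down_cellE ?ord3E /=; lia.
- move=> h; apply: cell_ext; rewrite /nbr /rot shiftE ?down_cell_down // ?up_cellE
      ?down_cellE ?ord3E /=; lia.
- by move/eqP->; apply: cell_ext; rewrite /nbr /rot shiftE ?down_cell_down // ?up_cellE
      ?down_cellE ?ord3E /=; lia.
Qed.

Lemma nbr_H i k : nbr i k \in H n x -> exists j, step i k j.
Proof.
have := (grid_row_lt i, grid_col_lt i) => -[hi ci].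
rewrite in_H /nbr !shiftE ?down_cell_down // !down_cellE.
case: (ord3P k) => ->; rewrite /step ?ord3E /= => /and5P[_ h0 h1 h2 h3].
- have [e|ne] := eqVneq (grid_row i).+1 n.
    (* This row is below n because the neighbour, whose first two coordinates are at least n, is not
       in the core. *)
    have [j [rj cj]] := @grid_ex (n + x - 1 - grid_col i) 0 ltac:(lia) ltac:(lia).
    by exists j; rewrite rj cj; lia.
  have [j [rj cj]] := @grid_ex (grid_row i).+1 (grid_col i) ltac:(lia) ltac:(lia).
  by exists j; rewrite rj cj !eqxx.
- have [j [rj cj]] := @grid_ex (grid_row i) (grid_col i).+1 ltac:(lia) ltac:(lia).
  by exists j; rewrite rj cj !eqxx.
- by exists i; rewrite eqxx.
Qed.

(** * Symmetric tilings encoded by a direction for each down triangle *)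

Definition lozenge r i k : {set cell (3 * n + x)} :=
  [set iter r rot (nbr i k); iter r rot (down_cell i)].

Lemma lozenge_mod r i k : lozenge r i k = lozenge (r %% 3) i k.
Proof. by rewrite /lozenge /rot ![iter r _ _]iter_rot120_mod. Qed.

Lemma rot_lozenge r i k : rot @: lozenge r i k = lozenge r.+1 i k.
Proof. by rewrite imsetU1 imset_set1. Qed.

Lemma is_lozenge_lozenge r i k : is_lozenge (lozenge r i k).
Proof.
apply/existsP; exists (iter r rot (nbr i k)).
apply/existsP; exists (iter r rot (down_cell i)); rewrite eqxx andbT.
rewrite iter_rot120_edge; apply/(share_edgeP side_gt0).
by split; [apply: down_cell_down | exists k].
Qed.

Lemma lozengeP (L : {set cell (3 * n + x)}) :
  is_lozenge L -> L \subset H n x -> exists r i k, L = lozenge r i k.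
Proof.
case/existsP=> s /existsP[t /andP[st /eqP->]] /subsetP sub.
have [r [i]] := in_H_rot (sub t (set22 _ _)).
have /(share_edgeP side_gt0)[dt _] := st.
case: ifP => [/up_not_down|_ e]; first by rewrite dt.
move: st; rewrite e -[s](iter_rot120K r) iter_rot120_edge.
by case/(share_edgeP side_gt0) => _ [k ->]; exists r, i, k.
Qed.

Lemma lozenge_down r i k c : c \in lozenge r i k -> is_down c ->
  c = iter r rot (down_cell i).
Proof.
case/set2P => -> //; rewrite /rot iter_rot120_down => d.
by have := @shift_up _ side_gt0 _ k (down_cell_down i); rewrite -/(nbr i k) => /up_not_down; rewrite d.
Qed.

Lemma lozenge_up r i k c : c \in lozenge r i k -> is_up c ->
  c = iter r rot (nbr i k).
Proof.
case/set2P => -> //; rewrite /rot iter_rot120_up => /up_not_down.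
by rewrite down_cell_down.
Qed.

Lemma lozenge_inj r r' i i' k k' : lozenge r i k = lozenge r' i' k' ->
  [/\ r = r' %[mod 3], i = i' & k = k'].
Proof.
move=> e; have : iter r rot (down_cell i) \in lozenge r' i' k'.
  by rewrite -e set22.
move/lozenge_down; rewrite /rot iter_rot120_down => /(_ (down_cell_down i)).
case/down_cell_inj => ei er; split=> //.
have : iter r rot (nbr i k) \in lozenge r' i' k' by rewrite -e set21.
have u := @shift_up _ side_gt0 _ k (down_cell_down i).
move/lozenge_up; rewrite /rot iter_rot120_up => /(_ u).
rewrite (iter_rot120_mod r) er -(iter_rot120_mod r') ei => /iter_rot120_inj.
by apply: shift_inj; apply: down_cell_down.
Qed.

Implicit Types f : {ffun 'I_(n * (n + x)) -> 'I_3}.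

Definition tiling_of f :=
  [set lozenge r i (f i) | r : 'I_3, i : 'I_(n * (n + x))].

Lemma tiling_ofP f L :
  reflect (exists r i, L = lozenge r i (f i)) (L \in tiling_of f).
Proof.
apply: (iffP imset2P) => [[r i _ _ ->]|[r [i ->]]]; first by exists r, i.
by exists (Ordinal (ltn_pmod r (isT : 0 < 3))) i; rewrite // lozenge_mod.
Qed.

Lemma tiling_of_inj : injective tiling_of.
Proof.
move=> f g e; apply/ffunP => i.
have : lozenge 0 i (f i) \in tiling_of g by rewrite -e; apply/tiling_ofP; exists 0, i.
by case/tiling_ofP => r [j] /lozenge_inj[_ -> ->].
Qed.

Lemma tiling_of_rot f : rot_invariant (tiling_of f).
Proof.
apply/eqP/setP => L; apply/imsetP/tiling_ofP.
  case=> _ /tiling_ofP[r [i ->]] ->; exists r.+1, i; exact: rot_lozenge.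
case=> r [i ->]; exists (lozenge (r + 2) i (f i)).
  by apply/tiling_ofP; exists (r + 2), i.
by rewrite -/rot rot_lozenge -addnS lozenge_mod [RHS]lozenge_mod modnDr.
Qed.

Lemma tiling_of_tiling f : valid_steps f -> is_tiling (H n x) (tiling_of f).
Proof.
case/existsP => s /forallP vf.
have nbrE r i : iter r rot (nbr i (f i)) =
    iter (r + wraps i (f i)) rot (up_cell (s i)).
  by rewrite (nbr_step (vf i)) iterD.
apply/andP; split; last first.
  apply/forall_inP => L /tiling_ofP[r [i ->]]; exact: is_lozenge_lozenge.
apply/and3P; split.
- apply/eqP/setP => c; apply/bigcupP/idP => [[_ /tiling_ofP[r [i ->]]] | cH].
    case/set2P => ->; last by rewrite iter_rot120_H down_cell_H.
    by rewrite nbrE iter_rot120_H up_cell_H.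
  have [r [j]] := in_H_rot cH; case: ifP => _ ->; last first.
    by exists (lozenge r j (f j)); rewrite ?set22 //; apply/tiling_ofP; exists r, j.
  pose i := (s^-1)%g j; pose b : nat := wraps i (f i).
  (* The wrap adds b rotations; 2b more make 3b, which is trivial. *)
  exists (lozenge (r + 2 * b) i (f i)); first by apply/tiling_ofP; exists (r + 2 * b), i.
  rewrite /lozenge nbrE permKV -/b -addnA -mulSnr (mulnC 3 b) /rot.
  by rewrite [iter (_ + _) _ _]iter_rot120_mod (addnC r) modnMDl -iter_rot120_mod set21.
- apply/trivIsetP => _ _ /tiling_ofP[r [i ->]] /tiling_ofP[r' [i' ->]].
  apply: contraNT => /pred0Pn[c /andP[/= c1 c2]].
  have eqL : i = i' -> r = r' %[mod 3] -> lozenge r i (f i) = lozenge r' i' (f i').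
    by move=> -> e; rewrite lozenge_mod e -lozenge_mod.
  have [dc|dc] := boolP (is_down c).
    have := lozenge_down c1 dc; rewrite (lozenge_down c2 dc) => /esym.
    by case/down_cell_inj => /eqL h /h ->.
  have uc : is_up c.
    case/set2P: c1 dc => ->; last by rewrite /rot iter_rot120_down down_cell_down.
    by rewrite /rot iter_rot120_up shift_up // down_cell_down.
  have := lozenge_up c1 uc; rewrite (lozenge_up c2 uc) !nbrE => /esym.
  case/up_cell_inj => /perm_inj ei; move: eqL; rewrite -ei => eqL /eqP.
  by rewrite eqn_modDr => /eqP er; rewrite (eqL _ er).
- by apply/negP => /tiling_ofP[r [i /setP/(_ (iter r rot (down_cell i)))]]; rewrite set22 inE.
Qed.

(** The lozenges at the unrotated down triangles define f, and invariance gives all others. The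
    induced map on up triangles is injective because two lozenges of T sharing a triangle
    coincide. *)
Lemma tiling_is_tiling_of (T : {set {set cell (3 * n + x)}}) :
  is_tiling (H n x) T -> rot_invariant T ->
  exists2 f, valid_steps f & T = tiling_of f.
Proof.
case/andP => /and3P[/eqP covT trivT _] /forall_inP lozT /eqP rotT.
have TH L : L \in T -> L \subset H n x.
  by move=> LT; rewrite -covT; apply: bigcup_sup.
have Tloz L : L \in T -> exists r i k, L = lozenge r i k.
  by move=> LT; apply: lozengeP; [apply: lozT | apply: TH].
have Tmeet c L L' : L \in T -> L' \in T -> c \in L -> c \in L' -> L = L'.
  move=> LT LT' cL cL'; rewrite -(def_pblock trivT LT cL).
  exact: def_pblock.
have Trot r i k : lozenge r i k \in T -> forall r', lozenge r' i k \in T.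
  have rT m : lozenge m i k \in T -> lozenge m.+1 i k \in T.
    by move=> h; rewrite -rot_lozenge -rotT; apply: imset_f.
  move=> h r'; have: lozenge (2 * r + r' + r) i k \in T.
    by elim: (2 * r + r') => //= m IH; rewrite addSn rT.
  by rewrite addnAC -mulSnr (mulnC 3 r) lozenge_mod modnMDl -lozenge_mod.
have ex i : exists k, lozenge 0 i k \in T.
  have: down_cell i \in cover T by rewrite covT down_cell_H.
  case/bigcupP => L LT; have [r [j [k eL]]] := Tloz L LT.
  rewrite eL => /lozenge_down/(_ (down_cell_down i)).
  case/(@down_cell_inj 0) => -> _; exists k; apply: (Trot r); by rewrite -eL.
pose f := [ffun i => xchoose (ex i)].
have fT i : lozenge 0 i (f i) \in T by rewrite ffunE; apply: (xchooseP (ex i)).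
have exs i : exists j, step i (f i) j.
  by apply: nbr_H; apply: (subsetP (TH _ (fT i))); apply: set21.
pose s i := xchoose (exs i).
have sP i : step i (f i) (s i) := xchooseP (exs i).
have s_inj : injective s.
  move=> i i' e; pose b j : nat := wraps j (f j).
  have up_in j : up_cell (s j) \in lozenge (2 * b j) j (f j).
    by rewrite /lozenge (nbr_step (sP j)) -iterD (addnC (2 * b j)) iterD /rot iter_rot120K set21.
  have := up_in i'; rewrite -e => up_in'.
  have := Tmeet _ _ _ (Trot _ _ _ (fT i) _) (Trot _ _ _ (fT i') _) (up_in i) up_in'.
  by case/lozenge_inj.
exists f.
  by apply/existsP; exists (perm s_inj); apply/forallP => i; rewrite permE.
apply/setP => L; apply/idP/tiling_ofP => [LT|[r [i ->]]]; last exact: Trot (fT i) r.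
have [r [i [k eL]]] := Tloz L LT.
exists r, i; apply: (Tmeet (iter r rot (down_cell i))) => //.
- exact: Trot (fT i) r.
- by rewrite eL set22.
- exact: set22.
Qed.

Lemma num_cs_tilings_steps : num_cs_tilings n x = #|[set f | valid_steps f]|.
Proof.
rewrite /num_cs_tilings -(card_imset _ tiling_of_inj); congr #|pred_of_set _|.
apply/setP => T; rewrite inE; apply/andP/imsetP => [[tT rT]|[f]].
  by have [f vf ->] := tiling_is_tiling_of tT rT; exists f; rewrite ?inE.
by rewrite inE => vf ->; split; [apply: tiling_of_tiling | apply: tiling_of_rot].
Qed.

End Grid.
(** * The sign of a permutation made of steps *)

Section Sign.

Variables (n x : nat) (f : {ffun 'I_(n * (n + x)) -> 'I_3}).
Variable s : {perm 'I_(n * (n + x))}.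
Hypothesis step_s : forall i, step i (f i) (s i).
Implicit Types i j c : 'I_(n * (n + x)).

Let moves i := f i != o2.
Let wrap i := wraps i (f i).
Let level i := grid_row i + grid_col i.

Lemma wrap_moves i : wrap i -> moves i.
Proof. by rewrite /wrap /moves /wraps => /andP[/eqP->]. Qed.

Lemma fixed_step i : ~~ moves i -> s i = i.
Proof. by rewrite negbK => /eqP fi; have := step_s i; rewrite fi => /eqP. Qed.

Lemma level_step i : moves i -> ~~ wrap i ->
  level (s i) = (level i).+1 /\ grid_col i <= grid_col (s i) <= (grid_col i).+1.
Proof.
rewrite /moves /wrap /wraps /level; have := step_s i.
by case: (ord3P (f i)) => ->; rewrite /step /= ?ord3E //=; lia.
Qed.

Lemma wrap_step i : wrap i -> [/\ (grid_row i).+1 = n, grid_col (s i) = 0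
  & grid_row (s i) + grid_col i + 1 = n + x].
Proof.
rewrite /wrap /wraps; have := step_s i; have := grid_row_lt (s i).
case: (ord3P (f i)) => ->; rewrite /step /= ?ord3E //= => h0 h1 /eqP h2.
by split; lia.
Qed.

Lemma moves_s i : moves (s i) = moves i.
Proof.
have [h|h] := boolP (moves i); last by rewrite fixed_step // (negPf h).
apply: contraT => nm.
by have /perm_inj e := fixed_step nm; rewrite e h in nm.
Qed.

(* The paths formed by the moves do not cross, so the number of paths to the
   right of a given one does not change along it.                           *)
Definition rank i :=
  #|[set c | [&& moves c, level c == level i & grid_col i < grid_col c]]|.

(** A forward step raises the level by one, so this is the number of paths crossing the antidiagonal
    of level l. *)
Definition level_count l := \sum_c (moves c && (level c == l)).

Lemma level_inj i j : level i = level j -> grid_col i = grid_col j -> i = j.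
Proof. by rewrite /level => ? ?; apply: grid_ext; lia. Qed.

(** A forward step changes the column by 0 or 1 and [s] is injective, so paths on one level keep
    their order. Cells to the right of i lie in earlier rows and do not wrap, and a cell reached by
    a wrap has column 0, to the right of nothing. *)
Lemma rank_step i : moves i -> ~~ wrap i -> rank (s i) = rank i.
Proof.
move=> mi wi; have [li ci] := level_step mi wi.
rewrite /rank -[RHS](card_imset _ (@perm_inj _ s)); congr #|pred_of_set _|.
apply/setP => c; rewrite inE; apply/and3P/imsetP => [[mc /eqP lc hc]|[d]].
  exists (s^-1%g c); last by rewrite permKV.
  have [e md] : s (s^-1%g c) = c /\ moves (s^-1%g c).
    by rewrite -moves_s permKV.
  rewrite inE md; have wd : ~~ wrap (s^-1%g c).
    by apply/negP => /wrap_step[_]; rewrite e => c0; rewrite c0 in hc.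
  have := level_step md wd; rewrite e => -[ld cd].
  suff : grid_col i != grid_col (s^-1%g c) by lia.
  apply/eqP => ec; have ed := level_inj (i := i) (j := s^-1%g c) _ ec.
  by move: hc; rewrite -e -ed ?ltnn //; lia.
rewrite inE => /and3P[md /eqP ld cd] ->.
have wd : ~~ wrap d.
  apply/negP => /wrap_step[rd _ _]; have := grid_row_lt i.
  by move: ld cd rd; rewrite /level; lia.
have [l1 c1] := level_step md wd; rewrite moves_s md; split=> //; first by lia.
suff : grid_col (s i) != grid_col (s d) by lia.
apply/eqP => e; have /perm_inj ed : s i = s d by apply: level_inj => //; lia.
by rewrite ed ltnn in cd.
Qed.

(** The last row and the first column are the leftmost places of a level. *)
Lemma rank_last i : moves i -> (grid_row i).+1 = n \/ grid_col i = 0 ->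
  (rank i).+1 = level_count (level i).
Proof.
move=> mi hi; rewrite /rank /level_count.
rewrite -[LHS]add1n -(cards1 i) -cardsUI (_ : _ :&: _ = set0) ?cards0 ?addn0; last first.
  by apply/setP => c; rewrite !inE; case: eqVneq => // ->; rewrite ltnn !andbF.
rewrite -sum1_card big_mkcond; apply: eq_bigr => c _ /=; rewrite !inE.
case: (eqVneq c i) => [->|ne] /=; first by rewrite mi eqxx.
case: (moves c) => //=; case: eqVneq => //= lc; case: ltnP => // hc.
case/eqP: ne; apply: level_inj => //.
by have := grid_row_lt c; move: lc hi hc; rewrite /level; lia.
Qed.

Lemma wrap_level i : wrap i -> level (s i) <= level i.
Proof.
move=> /wrap_step[]; have := grid_row_lt (s i); rewrite /level; lia.
Qed.

(** A path meets level l if it has begun by then and not ended before. Each wrap c ends a path at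
    [level c] and begins one at [level (s c)], which is no higher, so begun minus ended can be
    counted wrap by wrap. *)
Lemma level_countE l :
  level_count l = \sum_c (wrap c && (level (s c) <= l <= level c)).
Proof.
have reindex_s k : level_count k = \sum_c (moves c && (level (s c) == k)).
  rewrite /level_count (reindex_inj (@perm_inj _ s)) /=.
  by apply: eq_bigr => c _; rewrite moves_s.
elim: l => [|l IH].
  rewrite reindex_s; apply: eq_bigr => c _.
  rewrite leqn0 leq0n andbT; have [/wrap_moves -> //|nw] := boolP (wrap c).
  by case mc: (moves c) => //=; have [-> _] := level_step mc nw.
apply: (@addIn (level_count l)); rewrite {1}IH reindex_s /level_count -!big_split.
apply: eq_bigr => c _ /=.
have [wc|nw] := boolP (wrap c).
  by rewrite (wrap_moves wc) /=; have := wrap_level wc; lia.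
case mc: (moves c) => //=; have [-> _] := level_step mc nw; lia.
Qed.

(** For a wrap c in column q the levels from [s c] to c form the interval [n+x-1-q, n-1+q]. These
    intervals are concentric, so either end of that of i lies exactly in those with q at least the
    column of i. *)
Lemma rank_wrap i : wrap i ->
  (rank i).+1 = \sum_c (wrap c && (grid_col i <= grid_col c)) /\ rank (s i) = rank i.
Proof.
move=> wi; have [ri ci ri'] := wrap_step wi.
have mi := wrap_moves wi.
have E l : l = level i \/ l = level (s i) ->
    level_count l = \sum_c (wrap c && (grid_col i <= grid_col c)).
  move=> hl; rewrite level_countE; apply: eq_bigr => c _.
  case wc: (wrap c) => //=; congr nat_of_bool; have [rc cc rc'] := wrap_step wc.
  have := grid_row_lt (s i); have := grid_row_lt (s c).
  by move: hl; rewrite /level; lia.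
split; first by rewrite rank_last; [apply: E; left | | left].
apply/eqP; rewrite -eqSS !rank_last ?moves_s ?E //; by [left | right].
Qed.

Lemma rank_wrap_inj i j : wrap i -> wrap j -> rank i = rank j -> i = j.
Proof.
have lt a b : wrap a -> wrap b -> grid_col a < grid_col b -> rank b < rank a.
  move=> wa wb h; rewrite -ltnS (rank_wrap wa).1 (rank_wrap wb).1.
  rewrite [ltnRHS](bigD1 a) // [ltnLHS](bigD1 a) //= wa leqnn (leqNgt (grid_col b)) h.
  rewrite add0n add1n ltnS leq_sum // => c _.
  by case: (wrap c) => //=; lia.
move=> wi wj e; apply: level_inj; last first.
  by case: (ltngtP (grid_col i) (grid_col j)) => // [/(lt _ _ wi wj)|/(lt _ _ wj wi)];
    rewrite e ltnn.
have : grid_col i = grid_col j.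
  by case: (ltngtP (grid_col i) (grid_col j)) => // [/(lt _ _ wi wj)|/(lt _ _ wj wi)];
    rewrite e ltnn.
by have [ri _ _] := wrap_step wi; have [rj _ _] := wrap_step wj; rewrite /level; lia.
Qed.

Lemma rank_s i : rank (s i) = rank i.
Proof.
have [wi|wi] := boolP (wrap i); first by case: (rank_wrap wi).
by have [mi|/fixed_step -> //] := boolP (moves i); apply: rank_step.
Qed.

Lemma rank_porbit i j : j \in porbit s i -> rank j = rank i.
Proof. by case/porbitP => k ->; elim: k => [|k IH]; rewrite ?perm1 // expgSr permM rank_s. Qed.

(* Each path of moves is closed up by exactly one wrap. *)
Lemma card_porbits_steps : #|porbits s| = #|[set i | ~~ moves i || wrap i]|.
Proof.
have fixP i j : ~~ moves i -> porbit s i = porbit s j -> i = j.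
  move=> /fixed_step si /esym/eqP; rewrite eq_porbit_mem => /porbitP[k ->].
  by elim: k => [|k IH]; rewrite ?perm1 // expgSr permM -IH si.
rewrite -(card_in_imset (f := porbit s)); last first.
  move=> i j; rewrite !inE => /orP[/fixP h _ /h //|wi] /orP[/fixP h /esym/h //|wj].
  move=> /eqP; rewrite eq_porbit_mem => /rank_porbit; exact: rank_wrap_inj.
congr #|pred_of_set _|; apply/setP => A; apply/imsetP/imsetP => -[i _ ->];
  last by exists i.
(* Since forward steps raise the level, a cell of greatest level in its orbit is fixed or wraps. *)
have [c ic mc] := arg_maxnP level (porbit_id s i).
exists c; last by apply/eqP; rewrite eq_sym eq_porbit_mem.
rewrite inE; apply: contraT; rewrite negb_or negbK => /andP[h1 h2].
have [e _] := level_step h1 h2.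
have /mc : s c \in porbit s i.
  by rewrite -eq_porbit_mem -[s c]/(aperm c s) -[X in aperm c X](expg1 s) porbit_perm eq_porbit_mem.
by rewrite /= e ltnn.
Qed.

Local Open Scope ring_scope.

(** The sign has the parity of the number of cells minus the number of cycles, which is the number
    of forward steps. *)
Lemma sign_steps (R : pzRingType) :
  (-1) ^+ s * \prod_i (if moves i && ~~ wrap i then -1 else 1) = 1 :> R.
Proof.
rewrite -big_mkcond prodr_const -[_ ^+ #|_|]signr_odd -signr_addb /odd_perm card_porbits_steps.
set A := [set i | _].
have -> : #|(fun i => moves i && ~~ wrap i)| = #|~: A|.
  by apply: eq_card => i; rewrite !inE negb_or negbK.
by rewrite -(cardsC A) oddD; case: (odd _); case: (odd _).
Qed.

End Sign.

(** * The determinant of the steps *)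

(** The number of lattice paths from (r, q) to (r', q') with unit steps increasing one
    coordinate. *)
Definition paths (r q r' q' : nat) : nat :=
  if (r <= r') && (q <= q') then 'C(r' - r + (q' - q), r' - r) else 0.

Lemma paths_rec r q r' q' : paths r q r' q' =
  ((r == r') && (q == q') + paths r.+1 q r' q' + paths r q.+1 r' q')%N.
Proof.
rewrite /paths; case: (ltngtP r r') => hr; case: (ltngtP q q') => hq //=;
  rewrite ?hr ?hq ?subnn ?bin0 ?addn0 ?add0n ?binn //.
have -> : r' - r.+1 = (r' - r).-1 by lia.
have -> : q' - q.+1 = (q' - q).-1 by lia.
have : 0 < r' - r by lia.
have : 0 < q' - q by lia.
by case: (r' - r) => // a; case: (q' - q) => // b _ _; rewrite /= addSn binS addnS addSn addnC.
Qed.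

Section StepDeterminant.

Local Open Scope ring_scope.

(** Sylvester's identity: multiplying M by the unipotent U on the left or on the right
    triangularizes it with one or the other block. *)
Lemma det_addmulC (R : comNzRingType) m p (B : 'M[R]_(m, p)) (C : 'M[R]_(p, m)) :
  \det (1%:M + B *m C) = \det (1%:M + C *m B).
Proof.
pose M := block_mx 1%:M (- B) C 1%:M; pose U := block_mx 1%:M B 0 (1%:M : 'M[R]_p).
have dU : \det U = 1 by rewrite det_ublock !det1 mulr1.
transitivity (\det (U *m M)).
  rewrite mulmx_block !mul1mx !mulmx1 !mul0mx !add0r addNr det_lblock det1 mulr1.
  by rewrite addrC.
rewrite det_mulmx mulrC -det_mulmx mulmx_block !mul1mx !mulmx1 !mulmx0 !addr0 addrN.
by rewrite det_lblock det1 mul1r addrC.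
Qed.

Variables (R : comNzRingType) (n x : nat).
Implicit Types i j : 'I_(n * (n + x)).

Definition step_weight i (k : 'I_3) : R :=
  if (k != o2) && ~~ wraps i k then -1 else 1.

Definition step_mx : 'M[R]_(n * (n + x)) :=
  \matrix_(i, j) \sum_k step_weight i k * (step i k j)%:R.

Lemma card_valid_steps :
  #|[set f | @valid_steps n x f]|%:R = \det step_mx.
Proof.
rewrite -sum1_card natr_sum.
transitivity (\sum_(f : {ffun 'I_(n * (n + x)) -> 'I_3})
    \sum_(s : 'S_(n * (n + x))) [forall i, step i (f i) (s i)]%:R : R).
  rewrite big_mkcond; apply: eq_bigr => f _; rewrite inE /valid_steps.
  case: existsP => [[s st]|no].
    rewrite (bigD1 s) //= st big1 ?addr0 // => s' ne.
    case: forallP => // st'; case/eqP: ne; apply/permP => i.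
    exact: step_fun (st' i) (forallP st i).
  by rewrite big1 // => s _; case: forallP => // st; case: no; exists s; apply/forallP.
rewrite exchange_big; apply: eq_bigr => s _.
transitivity ((-1) ^+ s * \prod_i \sum_k step_weight i k * (step i k (s i))%:R).
  rewrite bigA_distr_bigA big_distrr; apply: eq_bigr => f _ /=.
  case: forallP => [st|/forallP/forallPn[i ni]].
    rewrite -[LHS](sign_steps st R); congr (_ * _); apply: eq_bigr => i _.
    by rewrite st mulr1.
  by rewrite (bigD1 i) //= (negPf ni) mulr0 mul0r mulr0.
by congr (_ * _); apply: eq_bigr => i _; rewrite mxE.
Qed.

Lemma sum_grid r q (F : nat -> nat -> R) :
  \sum_(i : 'I_(n * (n + x))) ((grid_row i == r) && (grid_col i == q))%:R * F (grid_row i) (grid_col i) =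
  if (r < n)%N && (q < n + x)%N then F r q else 0.
Proof.
case: ifPn => [/andP[hr hq]|h].
  have [i [ri qi]] := grid_ex hr hq.
  rewrite (bigD1 i) //= ri qi !eqxx mul1r big1 ?addr0 // => j ne.
  case: eqP => [rj|]; case: eqP => [qj|]; rewrite ?mul0r //.
  by case/eqP: ne; apply: grid_ext; rewrite ?ri ?qi.
apply: big1 => i _; case: eqP => [er|]; case: eqP => [eq|]; rewrite ?mul0r //.
by case/negP: h; rewrite -er -eq grid_row_lt grid_col_lt.
Qed.

(** Identity minus the nilpotent matrix of forward steps; the inverse is a geometric series, which
    counts paths. *)
Definition forward_mx : 'M[R]_(n * (n + x)) :=
  \matrix_(i, j) ((j == i)%:R
    - ((grid_row j == (grid_row i).+1) && (grid_col j == grid_col i))%:R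
    - ((grid_row j == grid_row i) && (grid_col j == (grid_col i).+1))%:R).

Definition paths_mx : 'M[R]_(n * (n + x)) :=
  \matrix_(i, j) (paths (grid_row i) (grid_col i) (grid_row j) (grid_col j))%:R.

(** The wrap leaving the last row at column x + j enters the first column at row n - 1 - j, so the
    wraps factor through dimension n. *)
Definition wrap_source : 'M[R]_(n * (n + x), n) :=
  \matrix_(i, j) ((grid_row i == n.-1) && (grid_col i == x + j)%N)%:R.

Definition wrap_target : 'M[R]_(n, n * (n + x)) :=
  \matrix_(j, i) ((grid_row i == n.-1 - j)%N && (grid_col i == 0))%:R.

Lemma forward_paths : forward_mx *m paths_mx = 1%:M.
Proof.
apply/matrixP => i j; rewrite !mxE.
under eq_bigr => k _ do rewrite !mxE !mulrDl !mulNr.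
rewrite !big_split /= !sumrN.
rewrite (sum_grid _ _ (fun r q => (paths r q (grid_row j) (grid_col j))%:R)).
rewrite (sum_grid _ _ (fun r q => (paths r q (grid_row j) (grid_col j))%:R)).
rewrite (bigD1 i) //= eqxx mul1r big1 ?addr0; last first.
  by move=> k /negPf ->; rewrite mul0r.
(* A step off the array may be included, since no path leads back from there. *)
have -> : (if ((grid_row i).+1 < n)%N && (grid_col i < n + x)%N then
    (paths (grid_row i).+1 (grid_col i) (grid_row j) (grid_col j))%:R else 0)
    = (paths (grid_row i).+1 (grid_col i) (grid_row j) (grid_col j))%:R :> R.
  rewrite grid_col_lt andbT; case: ltnP => // h; rewrite /paths.
  by have := grid_row_lt j; case: (leqP (grid_row i).+1) => //=; lia.
have -> : (if (grid_row i < n)%N && ((grid_col i).+1 < n + x)%N then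
    (paths (grid_row i) (grid_col i).+1 (grid_row j) (grid_col j))%:R else 0)
    = (paths (grid_row i) (grid_col i).+1 (grid_row j) (grid_col j))%:R :> R.
  rewrite grid_row_lt /=; case: ltnP => // h; rewrite /paths.
  by have := grid_col_lt j; case: (leqP (grid_col i).+1); rewrite ?andbF //=; lia.
transitivity (((grid_row i == grid_row j) && (grid_col i == grid_col j))%:R : R).
  by rewrite (paths_rec (grid_row i) (grid_col i)) !natrD; ring.
congr (_%:R); congr nat_of_bool; apply/andP/eqP => [[/eqP h /eqP h']|->//].
exact: grid_ext.
Qed.

Lemma det_forward : \det forward_mx = 1.
Proof.
rewrite -det_tr det_trig => [|]; last first.
  apply/is_trig_mxP => i j ij; rewrite !mxE.
  have e (k : 'I_(n * (n + x))) : k = (grid_row k * (n + x) + grid_col k)%N :> nat.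
    exact: divn_eq.
  have ne : (j == i) = false by apply/negbTE; rewrite neq_ltn ij orbT.
  rewrite (eq_sym i j) ne.
  move: (grid_col_lt i) (grid_col_lt j) ij; rewrite {1}(e i) {1}(e j) => ci cj lt_ij.
  have -> : (grid_row i == (grid_row j).+1) && (grid_col i == grid_col j) = false.
    by apply/negbTE/negP => /andP[/eqP ra /eqP ca]; nia.
  have -> : (grid_row i == grid_row j) && (grid_col i == (grid_col j).+1) = false.
    by apply/negbTE/negP => /andP[/eqP ra /eqP ca]; nia.
  by rewrite !subr0.
rewrite big1 // => i _; rewrite !mxE eqxx.
by rewrite !(ltn_eqF (ltnSn _)) ?andbF !subr0.
Qed.

Lemma step_mxE : step_mx = forward_mx + wrap_source *m wrap_target.
Proof.
apply/matrixP => i j; rewrite !mxE.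
have hi := grid_row_lt i; have hj := grid_row_lt j.
have -> : \sum_k wrap_source i k * wrap_target k j =
    [&& (grid_row i).+1 == n, grid_col j == 0 &
      (grid_row j + grid_col i + 1 == n + x)%N]%:R :> R.
  under eq_bigr => k _ do rewrite !mxE -natrM mulnb.
  case: and3P => [[/eqP ri /eqP cj /eqP e]|no].
    have h : (grid_col i - x < n)%N by lia.
    rewrite (bigD1 (Ordinal h)) //= big1 ?addr0 => [|k].
      by rewrite (_ : [&& _ & _]) //; lia.
    rewrite -val_eqE /= => ne.
    by rewrite (_ : [&& _ & _] = false) //; apply/negbTE; lia.
  apply: big1 => k _; rewrite (_ : [&& _ & _] = false) //; apply/negbTE/negP => h.
  by have hk := ltn_ord k; case: no; split; lia.
have -> (F : 'I_3 -> R) : \sum_k F k = F o0 + F o1 + F o2.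
  rewrite !big_ord_recr big_ord0 /= add0r.
  by congr (F _ + F _ + F _); apply: val_inj.
rewrite /step_weight /wraps !ord3E /= !mul1r mulN1r.
rewrite /step /=.
have [ri|nri] /= := eqVneq (grid_row i).+1 n.
  rewrite (_ : _ == (grid_row i).+1 = false) /= ?mul1r; last by apply/negbTE; lia.
  by rewrite subr0; ring.
by rewrite orbF; ring.
Qed.

(** What remains at (i, j) counts the paths from row n - 1 - i of the first column to column x + j
    of the last row: i steps one way and x + j the other. *)
Lemma det_step_mx : \det step_mx =
  \det (\matrix_(i < n, j < n) ((i == j)%:R + 'C(x + i + j, i)%:R)).
Proof.
have -> : step_mx = forward_mx *m (1%:M + paths_mx *m wrap_source *m wrap_target).
  by rewrite mulmxDr mulmx1 -mulmxA mulmxA forward_paths mul1mx step_mxE.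
rewrite det_mulmx det_forward mul1r det_addmulC; congr (\det _).
apply/matrixP => i j; rewrite mulmxA !mxE.
have hi := ltn_ord i; have hj := ltn_ord j.
congr (_ + _); transitivity ((paths (n.-1 - i) 0 n.-1 (x + j))%:R : R).
  under eq_bigr => k _ do rewrite !mxE mulrC.
  rewrite (eq_bigr (fun k : 'I_(n * (n + x)) =>
     ((grid_row k == n.-1) && (grid_col k == x + j)%N)%:R *
     (paths (n.-1 - i) 0 (grid_row k) (grid_col k))%:R)).
    by rewrite (sum_grid _ _ (fun r q => (paths (n.-1 - i) 0 r q)%:R)) ifT //; lia.
  move=> k _; congr (_ * _); under eq_bigr => l _ do rewrite !mxE.
  rewrite (sum_grid _ _ (fun r q => (paths r q (grid_row k) (grid_col k))%:R)) ifT //.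
  lia.
congr (_%:R); rewrite /paths leq_subr leq0n /= subKn ?subn0; last by lia.
by rewrite addnCA addnA.
Qed.

End StepDeterminant.

Lemma num_cs_tilings_det (R : comNzRingType) (n x : nat) : 0 < n ->
  ((num_cs_tilings n x)%:R = \det (\matrix_(i < n, j < n)
     ((i == j)%:R + 'C(x + i + j, i)%:R : R)))%R.
Proof.
by move=> n_gt0; rewrite (num_cs_tilings_steps x n_gt0) card_valid_steps det_step_mx.
Qed.

(** * Dodgson condensation *)

Section Condensation.

Local Open Scope ring_scope.

Definition minor_det (R : comNzRingType) (m : nat) (f : nat -> nat -> R) : R :=
  \det (\matrix_(i < m, j < m) f i j).

(** B is the identity with its first and last columns replaced by those of the adjugate. Then A B
    has determinant (\det A)^2 times the inner minor, while \det B is a 2 by 2 minor of the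
    adjugate; one factor \det A cancels. *)
Lemma desnanot_jacobi_domain (R : idomainType) (m : nat) (f : nat -> nat -> R) :
  minor_det m.+2 f != 0 ->
  minor_det m.+2 f * minor_det m (fun i j => f i.+1 j.+1) =
  minor_det m.+1 f * minor_det m.+1 (fun i j => f i.+1 j.+1)
  - minor_det m.+1 (fun i j => f i.+1 j) * minor_det m.+1 (fun i j => f i j.+1).
Proof.
rewrite /minor_det; set A := (\matrix_(i, j) _ : 'M_m.+2) => dA.
pose B : 'M[R]_m.+2 := \matrix_(i, j)
  if (j == ord0) || (j == ord_max) then (\adj A) i j else (i == j)%:R.
have AB i j : (A *m B) i j =
    if (j == ord0) || (j == ord_max) then (\det A) *+ (i == j) else A i j.
  rewrite !mxE; case: ifP => hj.
    transitivity ((A *m \adj A) i j); last by rewrite mul_mx_adj !mxE.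
    by rewrite mxE; apply: eq_bigr => k _; rewrite [B _ _]mxE hj.
  rewrite (bigD1 j) //= [B _ _]mxE hj eqxx mulr1 big1 ?addr0 => [|k /negPf kj].
    by rewrite mxE.
  by rewrite [B _ _]mxE hj kj mulr0.
have dAB : \det (A *m B) = \det A ^+ 2 * \det (\matrix_(i < m, j < m) f i.+1 j.+1).
  move: (A *m B) AB => M AB.
  rewrite (expand_det_col _ ord0) (bigD1 ord0) //= big1 ?addr0; last first.
    by move=> i /negPf i0; rewrite AB /= i0 mul0r.
  rewrite AB /= mulr1n expr2 -mulrA; congr (_ * _).
  rewrite /cofactor /= expr0 mul1r (expand_det_col _ ord_max) (bigD1 ord_max) //= big1 ?addr0.
    rewrite !mxE AB (_ : lift ord0 ord_max = ord_max); last exact: val_inj.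
    rewrite eqxx orbT mulr1n; congr (_ * _); rewrite /cofactor /= -signr_odd oddD addbb mul1r.
    congr (\det _); apply/matrixP => i j; rewrite !mxE AB ifF ?mxE /=; last first.
      rewrite -!val_eqE /= /bump /=; have := ltn_ord j; lia.
    by congr f; rewrite /bump /=; have := ltn_ord i; have := ltn_ord j; lia.
  move=> i ni; rewrite !mxE AB (_ : lift ord0 ord_max = ord_max) ?eqxx ?orbT; last exact: val_inj.
  rewrite -val_eqE /= (_ : _ == _ = false) ?mulr0n ?mul0r //.
  by apply/negbTE; move: ni; rewrite -val_eqE /= /bump /=; lia.
have dB : \det B = (\adj A) ord0 ord0 * (\adj A) ord_max ord_max
    - (\adj A) ord0 ord_max * (\adj A) ord_max ord0.
  have Be i j : B i j = if (j == ord0) || (j == ord_max) then (\adj A) i j else (i == j)%:R.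
    by rewrite mxE.
  move: B {AB dAB} Be => B Be; move: (\adj A) Be => a Be.
  rewrite (expand_det_row _ ord0) (bigD1 ord0) //= (bigD1 ord_max) //= big1 ?addr0; last first.
    move=> i /andP[n0 nm]; rewrite Be (negPf n0) (negPf nm) /= eq_sym (negPf n0).
    by rewrite mul0r.
  rewrite !Be !eqxx orbT /=; congr (_ * _ + _).
    rewrite /cofactor /= expr0 mul1r -det_tr det_trig => [|]; last first.
      apply/is_trig_mxP => i j ij; rewrite !mxE Be ifF.
        by rewrite (_ : _ == _ = false) // -val_eqE /= /bump /=; apply/negbTE; lia.
      by rewrite -!val_eqE /= /bump /=; have := ltn_ord j; lia.
    rewrite (bigD1 ord_max) //= big1 ?mulr1.
      rewrite !mxE Be (_ : lift ord0 ord_max = ord_max) ?eqxx ?orbT //.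
      exact: val_inj.
    move=> i ni; rewrite !mxE Be eqxx ifF //.
    by move: ni; rewrite -!val_eqE /= /bump /=; lia.
  rewrite -mulrN; congr (_ * _); rewrite /cofactor /= add0n.
  rewrite (expand_det_row _ ord_max) (bigD1 ord0) //= big1 ?addr0; last first.
    move=> j nj; rewrite !mxE Be ifF.
      rewrite (_ : _ == _ = false) ?mul0r //; apply/negbTE.
      by rewrite -val_eqE /= /bump /=; have := ltn_ord j; lia.
    move: nj; rewrite -!val_eqE /= /bump /=; have := ltn_ord j.
    by lia.
  have l1 : lift ord0 ord_max = ord_max :> 'I_m.+2 by exact: val_inj.
  have l2 : lift ord_max ord0 = ord0 :> 'I_m.+2 by exact: val_inj.
  rewrite !mxE Be l1 l2.
  rewrite eqxx /= /cofactor /= addn0 exprS mulN1r.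
  rewrite (_ : row' _ _ = 1%:M) ?det1 ?mulr1.
    by rewrite mulNr mulrCA -expr2 sqrr_sign mulr1.
  apply/matrixP => i j; rewrite !mxE Be ifF.
    congr (_%:R); rewrite -!val_eqE /= /bump /=; have := ltn_ord j; have := ltn_ord i.
    by move=> hi hj; congr nat_of_bool; lia.
  by rewrite -!val_eqE /= /bump /=; have := ltn_ord j; lia.
have := det_mulmx A B; rewrite dAB dB expr2 -mulrA => /(mulfI dA) ->.
have minorE (p q : 'I_m.+2) g :
    (forall i j : 'I_m.+1, f (lift p i) (lift q j) = g i j) ->
    \det (row' p (col' q A)) = \det (\matrix_(i < m.+1, j < m.+1) g i j).
  by move=> e; congr (\det _); apply/matrixP => i j; rewrite !mxE e.
have bump_max (i : 'I_m.+1) : bump m.+1 i = i.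
  by rewrite /bump leqNgt ltn_ord.
rewrite !mxE /cofactor.
rewrite (@minorE ord0 ord0 (fun i j => f i.+1 j.+1)) //.
rewrite (@minorE ord_max ord_max f) => [|i j]; last by rewrite /= !bump_max.
rewrite (@minorE ord_max ord0 (fun i j => f i j.+1)) => [|i j]; last first.
  by rewrite /= bump_max.
rewrite (@minorE ord0 ord_max (fun i j => f i.+1 j)) => [|i j]; last first.
  by rewrite /= bump_max.
rewrite /= add0n addn0 expr0 mul1r -signr_odd oddD addbb mul1r mulrACA -expr2 sqrr_sign.
by rewrite mul1r mulrC [X in _ - X]mulrC.
Qed.

(* Both sides are polynomial in the entries, so that the nonvanishing
   condition can be obtained by adding an indeterminate on the diagonal. *)
Lemma desnanot_jacobi (R : idomainType) (m : nat) (f : nat -> nat -> R) :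
  minor_det m.+2 f * minor_det m (fun i j => f i.+1 j.+1) =
  minor_det m.+1 f * minor_det m.+1 (fun i j => f i.+1 j.+1)
  - minor_det m.+1 (fun i j => f i.+1 j) * minor_det m.+1 (fun i j => f i j.+1).
Proof.
pose F i j := (f i j)%:P + (i == j)%:R * 'X.
have evalF k r c : (minor_det k (fun i j => F (r + i)%N (c + j)%N)).[0] =
    minor_det k (fun i j => f (r + i)%N (c + j)%N).
  rewrite /minor_det -[LHS]/(horner_eval 0 _) -det_map_mx; congr (\det _).
  apply/matrixP => i j; by rewrite !mxE /= /horner_eval /F !hornerE.
have F0 : minor_det m.+2 F != 0.
  rewrite (_ : minor_det _ _ = char_poly (\matrix_(i < m.+2, j < m.+2) - f i j)).
    by apply: monic_neq0; apply: char_poly_monic.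
  rewrite /char_poly /minor_det; congr (\det _); apply/matrixP => i j.
  by rewrite !mxE raddfN /= opprK /F addrC -val_eqE mulr_natl.
have := congr1 (horner^~ 0) (desnanot_jacobi_domain F0).
rewrite /= !(hornerD, hornerN, hornerM).
have := (evalF m 1%N 1%N, evalF m.+1 1%N 1%N, evalF m.+1 1%N 0%N, evalF m.+1 0%N 1%N, 
  evalF m.+1 0%N 0%N, evalF m.+2 0%N 0%N).
by rewrite /minor_det => -[[[[[-> ->] ->] ->] ->] ->].
Qed.

End Condensation.

(** * A determinant of factorials *)

Section MillsRobbinsRumsey.

Local Open Scope ring_scope.

Lemma eq_minor_det (R : comNzRingType) m (f g : nat -> nat -> R) :
  (forall i j, f i j = g i j) -> minor_det m f = minor_det m g.
Proof. by move=> e; congr (\det _); apply/matrixP => i j; rewrite !mxE e. Qed.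

(* With x = X - 1 and y = Y - 1 the entry is
   (x + y + i + j - 1)! / ((x + 2 i - j)! (y + 2 j - i)!), where the inverse of
   the factorial of a negative integer is 0; the cases x = -1 and y = -1 are
   needed in the recursion.                                                 *)
Definition mrr_entry (X Y i j : nat) : rat :=
  if (j < X + 2 * i)%N && (i < Y + 2 * j)%N then
    ((X + Y + i + j - 3)`!)%:R / ((X + 2 * i - j - 1)`! * (Y + 2 * j - i - 1)`!)%:R
  else 0.

(** The quotient of the determinants of orders i + 1 and i in the Mills-Robbins-Rumsey
    evaluation. *)
Definition mrr_factor (x y i : nat) : rat :=
  (i`! * (x + y + i - 1)`! * rising (2 * x + y + 2 * i) i
    * rising (x + 2 * y + 2 * i) i)%:R / ((x + 2 * i)`! * (y + 2 * i)`!)%:R.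

Definition mrr_prod (n x y : nat) : rat := \prod_(i < n) mrr_factor x y i.

Lemma natr_fact_neq0 k : (k`!)%:R != 0 :> rat.
Proof. by rewrite Num.Theory.pnatr_eq0 -lt0n fact_gt0. Qed.

Lemma rising_neq0 a k : (0 < a)%N -> (rising a k)%:R != 0 :> rat.
Proof.
by move=> a0; rewrite Num.Theory.pnatr_eq0 -lt0n prodn_gt0 // => i; rewrite addn_gt0 a0.
Qed.

Lemma risingS a k : rising a k.+1 = (a * rising a.+1 k)%N.
Proof.
rewrite /rising big_ord_recl addn0; congr (_ * _)%N.
by apply: eq_bigr => i _; rewrite /= /bump addSnnS.
Qed.

Lemma rising0 a : rising a 0 = 1%N.
Proof. by rewrite /rising big_ord0. Qed.

(** The product of the two mixed minors in the condensation, divided by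
    [mrr_prod n.+1 x y * mrr_prod n x.+1 y.+1]. The factors x and y make it vanish when a mixed
    minor has a parameter -1. *)
Definition mrr_ratio (n x y : nat) : rat :=
  (n`! * (x + y) * (x + y + n)`! * x * y * rising (2 * x + y + 3 + 2 * n) n
    * rising (x + 2 * y + 3 + 2 * n) n)%:R
  / ((x + 2 * n + 2)`! * (y + 2 * n + 2)`!)%:R.

Lemma mrr_prod_neq0 n x y : (0 < x + y)%N -> mrr_prod n x y != 0.
Proof.
move=> xy; apply/prodf_neq0 => i _; rewrite /mrr_factor !natrM.
by rewrite !mulf_neq0 ?invr_neq0 ?mulf_neq0 ?natr_fact_neq0 ?rising_neq0 //; lia.
Qed.

Lemma mrr_prodS n x y : mrr_prod n.+1 x y = mrr_prod n x y * mrr_factor x y n.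
Proof. by rewrite /mrr_prod big_ord_recr. Qed.

(** Induction on n: consecutive cases differ by single factors, related by [step]. Bringing all
    arguments to a common form lets [ring] treat factorials and rising factorials as atoms. *)
Lemma mrr_prod_ratio n x y :
  mrr_prod n.+1 x y.+3 * mrr_prod n.+1 x.+3 y =
  mrr_ratio n x.+1 y.+1 * mrr_prod n.+1 x.+1 y.+1 * mrr_prod n x.+2 y.+2.
Proof.
have step k : mrr_factor x y.+3 k.+1 * mrr_factor x.+3 y k.+1 * mrr_ratio k x.+1 y.+1
    = mrr_ratio k.+1 x.+1 y.+1 * mrr_factor x.+1 y.+1 k.+1 * mrr_factor x.+2 y.+2 k.
  rewrite /mrr_factor /mrr_ratio.
  have -> : (x + y.+3 + k.+1 - 1 = x + y + k + 3)%N by lia.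
  have -> : (x.+3 + y + k.+1 - 1 = x + y + k + 3)%N by lia.
  have -> : (x.+1 + y.+1 + k.+1 = x + y + k + 3)%N by lia.
  have -> : (x.+2 + y.+2 + k - 1 = x + y + k + 3)%N by lia.
  have -> : (x.+1 + y.+1 + k = x + y + k + 2)%N by lia.
  have -> : (x + y + k + 3 - 1 = x + y + k + 2)%N by lia.
  have -> : (2 * x + y.+3 + 2 * k.+1 = 2 * x + y + 2 * k + 5)%N by lia.
  have -> : (2 * x.+1 + y.+1 + 2 * k.+1 = 2 * x + y + 2 * k + 5)%N by lia.
  have -> : (2 * x.+3 + y + 2 * k.+1 = 2 * x + y + 2 * k + 8)%N by lia.
  have -> : (2 * x.+1 + y.+1 + 3 + 2 * k.+1 = 2 * x + y + 2 * k + 8)%N by lia.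
  have -> : (2 * x.+1 + y.+1 + 3 + 2 * k = 2 * x + y + 2 * k + 6)%N by lia.
  have -> : (2 * x.+2 + y.+2 + 2 * k = 2 * x + y + 2 * k + 6)%N by lia.
  have -> : (x + 2 * y.+3 + 2 * k.+1 = x + 2 * y + 2 * k + 8)%N by lia.
  have -> : (x.+1 + 2 * y.+1 + 3 + 2 * k.+1 = x + 2 * y + 2 * k + 8)%N by lia.
  have -> : (x.+1 + 2 * y.+1 + 2 * k.+1 = x + 2 * y + 2 * k + 5)%N by lia.
  have -> : (x.+3 + 2 * y + 2 * k.+1 = x + 2 * y + 2 * k + 5)%N by lia.
  have -> : (x.+1 + 2 * y.+1 + 3 + 2 * k = x + 2 * y + 2 * k + 6)%N by lia.
  have -> : (x.+2 + 2 * y.+2 + 2 * k = x + 2 * y + 2 * k + 6)%N by lia.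
  have e1 z : (z.+1 + 2 * k.+1 + 2 = z + 2 * k + 5)%N by lia.
  have e2 z : (z.+3 + 2 * k.+1 = z + 2 * k + 5)%N by lia.
  have e3 z : (z.+1 + 2 * k + 2 = z + 2 * k + 3)%N by lia.
  have e4 z : (z.+1 + 2 * k.+1 = z + 2 * k + 3)%N by lia.
  have e5 z : (z + 2 * k.+1 = z + 2 * k + 2)%N by lia.
  have e6 z : (z.+2 + 2 * k = z + 2 * k + 2)%N by lia.
  by rewrite !(e1, e2, e3, e4, e5, e6) !natrM !invfM; ring.
elim: n => [|n IH].
  rewrite /mrr_prod !big_ord_recr !big_ord0 /= !mul1r mulr1.
  rewrite /mrr_factor /mrr_ratio !muln0 !addn0 !rising0 !muln1 !fact0 !mul1n.
  have -> : (x + y.+3 - 1 = (x + y).+2)%N by lia.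
  have -> : (x.+3 + y - 1 = (x + y).+2)%N by lia.
  have -> : (x.+1 + y.+1 - 1 = (x + y).+1)%N by lia.
  have -> : (x.+1 + y.+1 = (x + y).+2)%N by lia.
  have -> : (x.+1 + 2 = x.+3)%N by lia.
  have -> : (y.+1 + 2 = y.+3)%N by lia.
  rewrite !factS !natrM.
  by field; rewrite !natr_fact_neq0 !nat1r -!natrD !Num.Theory.pnatr_eq0.
rewrite !(mrr_prodS n.+1) (mrr_prodS n x.+2) mulrACA IH.
transitivity (mrr_prod n.+1 x.+1 y.+1 * mrr_prod n x.+2 y.+2 *
  (mrr_factor x y.+3 n.+1 * mrr_factor x.+3 y n.+1 * mrr_ratio n x.+1 y.+1)).
  by ring.
by rewrite step; ring.
Qed.

Lemma mrr_prod_rec n x y : (0 < x + y)%N ->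
  mrr_prod n.+2 x y * mrr_prod n x.+1 y.+1 =
  mrr_prod n.+1 x y * mrr_prod n.+1 x.+1 y.+1
  - mrr_ratio n x y * (mrr_prod n.+1 x y * mrr_prod n x.+1 y.+1).
Proof.
move=> xy; rewrite !(mrr_prodS n.+1) (mrr_prodS n x.+1).
(* All three terms share [mrr_prod n.+1 x y * mrr_prod n x.+1 y.+1]. *)
suff -> : mrr_factor x y n.+1 = mrr_factor x.+1 y.+1 n - mrr_ratio n x y by ring.
rewrite /mrr_factor /mrr_ratio.
have -> : (x + y + n.+1 - 1 = x + y + n)%N by lia.
have -> : (x.+1 + y.+1 + n - 1 = (x + y + n).+1)%N by lia.
have -> : (2 * x.+1 + y.+1 + 2 * n = (2 * x + y + 2 * n.+1).+1)%N by lia.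
have -> : (x.+1 + 2 * y.+1 + 2 * n = (x + 2 * y + 2 * n.+1).+1)%N by lia.
have -> : (2 * x + y + 3 + 2 * n = (2 * x + y + 2 * n.+1).+1)%N by lia.
have -> : (x + 2 * y + 3 + 2 * n = (x + 2 * y + 2 * n.+1).+1)%N by lia.
have e1 z : (z + 2 * n + 2 = (z + 2 * n).+2)%N by lia.
have e2 z : (z + 2 * n.+1 = (z + 2 * n).+2)%N by lia.
have e3 z : (z.+1 + 2 * n = (z + 2 * n).+1)%N by lia.
rewrite !(e1, e2, e3) !risingS !factS !natrM.
rewrite -?natr1 ?natrD ?natrM.
by field; rewrite !natr_fact_neq0 -!natrD !natr1 !Num.Theory.pnatr_eq0.
Qed.

Lemma minor_det_row0 n (f : nat -> nat -> rat) :
  (forall j, f 0 j = 0) -> minor_det n.+1 f = 0.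
Proof.
move=> f0; rewrite /minor_det (expand_det_row _ ord0) big1 // => j _.
by rewrite mxE f0 mul0r.
Qed.

Lemma minor_det_col0 n (f : nat -> nat -> rat) :
  (forall i, f i 0 = 0) -> minor_det n.+1 f = 0.
Proof.
move=> f0; rewrite /minor_det (expand_det_col _ ord0) big1 // => j _.
by rewrite mxE f0 mul0r.
Qed.

(** Shifting both indices, the row index or the column index replaces (x, y) by (x+1, y+1), (x+2,
    y-1) or (x-1, y+2), so condensation is a recursion within the family. *)
Lemma mrr_det n x y : (0 < x + y)%N ->
  minor_det n (mrr_entry x.+1 y.+1) = mrr_prod n x y.
Proof.
elim/ltn_ind: n x y => -[|[|n]] IH x y xy.
- by rewrite /minor_det det_mx00 /mrr_prod big_ord0.
- rewrite /minor_det det_mx11 mxE /mrr_prod big_ord_recr big_ord0 /= mul1r.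
  rewrite /mrr_entry /mrr_factor !muln0 !addn0 !rising0 !fact0 !muln1 !mul1n /=.
  by congr (_`!%:R / (_`! * _`!)%:R); lia.
have := desnanot_jacobi n (mrr_entry x.+1 y.+1).
have E1 k : minor_det k (fun i j => mrr_entry x.+1 y.+1 i.+1 j.+1) =
    minor_det k (mrr_entry x.+2 y.+2).
  apply: eq_minor_det => i j; rewrite /mrr_entry.
  have -> : (j.+1 < x.+1 + 2 * i.+1)%N = (j < x.+2 + 2 * i)%N by lia.
  have -> : (i.+1 < y.+1 + 2 * j.+1)%N = (i < y.+2 + 2 * j)%N by lia.
  by case: ifP => // _; congr (_`!%:R / (_`! * _`!)%:R); lia.
have E2 k : minor_det k (fun i j => mrr_entry x.+1 y.+1 i.+1 j) =
    minor_det k (mrr_entry x.+3 y).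
  apply: eq_minor_det => i j; rewrite /mrr_entry.
  have -> : (j < x.+1 + 2 * i.+1)%N = (j < x.+3 + 2 * i)%N by lia.
  have -> : (i.+1 < y.+1 + 2 * j)%N = (i < y + 2 * j)%N by lia.
  by case: ifP => // _; congr (_`!%:R / (_`! * _`!)%:R); lia.
have E3 k : minor_det k (fun i j => mrr_entry x.+1 y.+1 i j.+1) =
    minor_det k (mrr_entry x y.+3).
  apply: eq_minor_det => i j; rewrite /mrr_entry.
  have -> : (j.+1 < x.+1 + 2 * i)%N = (j < x + 2 * i)%N by lia.
  have -> : (i < y.+1 + 2 * j.+1)%N = (i < y.+3 + 2 * j)%N by lia.
  by case: ifP => // _; congr (_`!%:R / (_`! * _`!)%:R); lia.
rewrite !{}E1 {}E2 {}E3 (IH n) ?(IH n.+1) //.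
have -> : minor_det n.+1 (mrr_entry x.+3 y) * minor_det n.+1 (mrr_entry x y.+3) =
    mrr_ratio n x y * (mrr_prod n.+1 x y * mrr_prod n x.+1 y.+1).
  (* If x = 0 or y = 0, a parameter -1 occurs and the first row or column of that minor is zero. *)
  case: x y xy => [|x] [|y] xy //.
  - rewrite [X in _ * X]minor_det_row0 => [|j]; last by rewrite /mrr_entry muln0.
    by rewrite /mrr_ratio !(mul0n, muln0) !mul0r mulr0.
  - rewrite [X in X * _]minor_det_col0 => [|i]; last by rewrite /mrr_entry muln0 andbF.
    by rewrite /mrr_ratio !(mul0n, muln0) !mul0r.
  - by rewrite !IH ?addnS // mulrC mrr_prod_ratio mulrA.
rewrite -mrr_prod_rec //; apply: mulIf; exact: mrr_prod_neq0.
Qed.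

End MillsRobbinsRumsey.

(** * Determinants split by parity *)

Section Checkerboard.

Local Open Scope ring_scope.

Lemma det_reindex (R : comNzRingType) m p (h : 'I_m -> 'I_p) (A : 'M[R]_p) :
  m = p -> injective h -> \det (\matrix_(i, j) A (h i) (h j)) = \det A.
Proof.
move=> e; case: p / e h A => h A h_inj.
rewrite (_ : \matrix_(i, j) _ = row_perm (perm h_inj) (col_perm (perm h_inj) A)).
  rewrite row_permE col_permE !det_mulmx !det_perm odd_permV mulrCA.
  by rewrite -expr2 sqrr_sign mulr1.
by apply/matrixP => i j; rewrite !mxE !permE.
Qed.

(** Listing even indices before odd ones, in rows and columns alike, costs no sign and separates the
    blocks. *)
Lemma det_checkerboard (R : comNzRingType) m (g : nat -> nat -> R) :
  \det (\matrix_(i < m, j < m) if odd i == odd j then g i j else 0) =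
  minor_det (uphalf m) (fun i j => g (2 * i) (2 * j))%N *
  minor_det m./2 (fun i j => g (2 * i).+1 (2 * j).+1)%N.
Proof.
have em : (uphalf m + m./2 = m)%N by rewrite uphalf_half -addnA addnn odd_double_half.
have he (i : 'I_(uphalf m)) : (2 * i < m)%N.
  move: (nat_of_ord i) (ltn_ord i) => k; rewrite uphalf_half.
  by have := odd_double_half m; case: (odd m); lia.
have ho (i : 'I_(m./2)) : ((2 * i).+1 < m)%N.
  by have := ltn_ord i; have := odd_double_half m; lia.
pose h (i : 'I_(uphalf m + m./2)) : 'I_m :=
  match split i with inl k => Ordinal (he k) | inr k => Ordinal (ho k) end.
have hl k : h (lshift _ k) = Ordinal (he k).
  by rewrite /h (unsplitK (inl _ k)).
have hr k : h (rshift _ k) = Ordinal (ho k).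
  by rewrite /h (unsplitK (inr _ k)).
have h_inj : injective h.
  move=> i j; rewrite -[i]splitK -[j]splitK.
  case: (split i) => k; case: (split j) => l; rewrite /= ?hl ?hr => -[e];
    by [have -> : k = l by apply: val_inj => /=; lia | lia].
rewrite -(det_reindex _ em h_inj).
set A := (\matrix_(i, j) _ : 'M_(uphalf m + m./2)).
rewrite -[A]submxK (_ : ursubmx A = 0); last first.
  by apply/matrixP => i j; rewrite !mxE hl hr /= !mul2n /= !odd_double.
rewrite det_lblock /minor_det; congr (_ * _); congr (\det _); apply/matrixP => i j.
  by rewrite !mxE !hl /= !mul2n !odd_double.
by rewrite !mxE !hr /= !mul2n /= !odd_double.
Qed.

Lemma minor_det_scale_row (R : comNzRingType) m (a : nat -> R) (f : nat -> nat -> R) :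
  minor_det m (fun i j => a i * f i j) = (\prod_(i < m) a i) * minor_det m f.
Proof.
rewrite /minor_det.
rewrite (_ : (\matrix_(i < m, j < m) _) = diag_mx (\row_i a i) *m \matrix_(i, j) f i j).
  by rewrite det_mulmx det_diag; congr (_ * _); apply: eq_bigr => i _; rewrite mxE.
by apply/matrixP => i j; rewrite mul_diag_mx !mxE.
Qed.

Lemma minor_det_scale_col (R : comNzRingType) m (a : nat -> R) (f : nat -> nat -> R) :
  minor_det m (fun i j => a j * f i j) = (\prod_(i < m) a i) * minor_det m f.
Proof.
have tr g : minor_det m g = minor_det m (fun i j => g j i) :> R.
  by rewrite /minor_det -det_tr; congr (\det _); apply/matrixP => i j; rewrite !mxE.
by rewrite tr minor_det_scale_row -tr.
Qed.

End Checkerboard.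

(** * Eigenvectors of the substitution X := 1 - X *)

Section Pairing.

Local Open Scope ring_scope.

Implicit Types f e p : {poly rat}.

Lemma coef_1subXn k t : (((1 - 'X) ^+ k : {poly rat})`_t) = (-1) ^+ t * 'C(k, t)%:R.
Proof.
elim: k t => [|k IH] t.
  by rewrite expr0 coef1 bin0n eq_sym; case: t => [|t]; rewrite ?mulr1 ?mulr0.
rewrite exprS mulrBl mul1r coefB coefXM; case: t => [|t] /=.
  by rewrite subr0 IH !bin0.
by rewrite !IH binS natrD exprS; ring.
Qed.

Lemma coef_comp_1subX p s t : (size p <= s)%N ->
  (p \Po (1 - 'X))`_t = \sum_(i < s) p`_i * ((-1) ^+ t * 'C(i, t)%:R).
Proof.
move=> sp; rewrite comp_polyE coef_sum.
rewrite (big_ord_widen _ (fun i => (p`_i *: (1 - 'X : {poly rat}) ^+ i)`_t) sp).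
rewrite [RHS](bigID (fun i : 'I_s => (i < size p)%N)) /= [X in _ = _ + X]big1 ?addr0.
  by apply: eq_bigr => i _; rewrite coefZ coef_1subXn.
by move=> i; rewrite -leqNgt => h; rewrite nth_default // mul0r.
Qed.

(** The coefficient of X^m in f(X) e(1/X). *)
Definition pairing f e (m : nat) : rat := \sum_(i < size e) f`_(i + m) * e`_i.

Lemma pairingE f e m s : (size e <= s)%N ->
  pairing f e m = \sum_(i < s) f`_(i + m) * e`_i.
Proof.
move=> se; rewrite /pairing (big_ord_widen _ (fun i => f`_(i + m) * e`_i) se).
rewrite [RHS](bigID (fun i : 'I_s => (i < size e)%N)) /= [X in _ = _ + X]big1 ?addr0 //.
by move=> i; rewrite -leqNgt => h; rewrite [X in _ * X]nth_default // mulr0.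
Qed.

Lemma pairingDr f e e' m : pairing f (e + e') m = pairing f e m + pairing f e' m.
Proof.
have s1 := leq_maxl (size e) (size e'); have s2 := leq_maxr (size e) (size e').
rewrite (pairingE _ _ s1) (pairingE _ _ s2) (pairingE _ _ (size_polyD e e')).
by rewrite -big_split; apply: eq_bigr => i _; rewrite coefD mulrDr.
Qed.

Lemma pairingNr f e m : pairing f (- e) m = - pairing f e m.
Proof. by rewrite /pairing size_polyN -sumrN; apply: eq_bigr => i _; rewrite coefN mulrN. Qed.

Lemma pairingDl f f' e m : pairing (f + f') e m = pairing f e m + pairing f' e m.
Proof. by rewrite -big_split; apply: eq_bigr => i _; rewrite coefD mulrDl. Qed.

Lemma pairingNl f e m : pairing (- f) e m = - pairing f e m.
Proof. by rewrite -sumrN; apply: eq_bigr => i _; rewrite coefN mulNr. Qed.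

Lemma pairingXr f e m : pairing f ('X * e) m = pairing f e m.+1.
Proof.
have s : (size ('X * e)%R <= (size e).+1)%N 
  by apply: leq_trans (size_polyMleq _ _) _; rewrite size_polyX.
rewrite (pairingE _ _ s) big_ord_recl coefXM mulr0 add0r.
by apply: eq_bigr => i _; rewrite coefXM /= /bump /= add1n addSnnS.
Qed.

Lemma pairingXl f e m : pairing ('X * f) e m.+1 = pairing f e m.
Proof. by apply: eq_bigr => i _; rewrite addnS coefXM. Qed.

Let w : {poly rat} := 'X * ('X - 1).
Let v : {poly rat} := 'X + 'X - 1.

(** This is w(1/X) = (1 - X) / X^2; likewise [pairing_vwn] uses v(1/X) = (2 - X) / X. *)
Lemma pairing_w f e m : pairing f (w * e) m = pairing ((1 - 'X) * f) e m.+2.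
Proof.
rewrite /w -mulrA pairingXr mulrBl mul1r pairingDr pairingNr pairingXr.
by rewrite mulrBl mul1r pairingDl pairingNl pairingXl.
Qed.

Lemma pairing_wn f k m : pairing f (w ^+ k) m = ((1 - 'X) ^+ k * f)`_(m + 2 * k).
Proof.
elim: k f m => [|k IH] f m.
  by rewrite expr0 /pairing size_poly1 big_ord_recl big_ord0 coef1 mul1r mulr1 addr0 muln0 addn0.
by rewrite exprS pairing_w IH mulrA -exprSr mulnS !addSnnS addnA.
Qed.

Lemma pairing_vwn f k m :
  pairing f (v * w ^+ k) m = ((1 - 'X) ^+ k * ((1 + 1 - 'X) * f))`_(m.+1 + 2 * k).
Proof.
rewrite -pairing_wn /v mulrBl mulrDl mul1r !pairingDr pairingNr !pairingXr.
by rewrite mulrBl mulrDl mul1r !pairingDl pairingNl pairingXl.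
Qed.

(** The degree is 2x + 1 + r, so the coefficients from 2x + 1 on form a triangular matrix; its
    parity decides whether v occurs. *)
Definition row_poly (x r : nat) : {poly rat} := v ^+ (~~ odd r) * w ^+ (x + uphalf r).
Definition col_poly (c : nat) : {poly rat} := v ^+ odd c * w ^+ c./2.

Lemma w_comp : w \Po (1 - 'X) = w.
Proof. by rewrite /w rmorphM /= rmorphB /= rmorph1 comp_polyX; ring. Qed.

Lemma v_comp : v \Po (1 - 'X) = - v.
Proof. by rewrite /v rmorphB rmorphD /= rmorph1 comp_polyX; ring. Qed.

Lemma vw_comp (b : bool) k :
  (v ^+ b * w ^+ k) \Po (1 - 'X) = (-1) ^+ b * (v ^+ b * w ^+ k).
Proof.
rewrite rmorphM !rmorphXn /= w_comp v_comp.
by case: b; rewrite /= ?expr0 ?expr1; ring.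
Qed.

Lemma size_lead_vw (b : bool) k : size (v ^+ b * w ^+ k) = (b + 2 * k).+1 /\
  lead_coef (v ^+ b * w ^+ k) = 2%:R ^+ b.
Proof.
have wE : w = ('X - 0%:P) * ('X - 1%:P) by rewrite /w subr0.
have vE : v = 2%:R *: ('X - (2%:R^-1)%:P).
  rewrite /v scalerBr scale_polyC mulfV // -mulr2n scaler_nat.
  by [].
have mw : w ^+ k \is monic by rewrite wE monic_exp // monicMl monicXsubC.
have sw : size (w ^+ k) = (2 * k).+1.
  rewrite -[LHS]prednK ?size_poly_gt0 ?monic_neq0 // size_exp wE.
  by rewrite size_mul ?polyXsubC_eq0 // !size_XsubC.
case: b; rewrite ?expr0 ?mul1r ?expr1 ?sw ?(monicP mw) //.
rewrite lead_coefM (monicP mw) mulr1 vE -scalerAl size_scale // lead_coefZ.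
rewrite lead_coefXsubC mulr1 size_Mmonic ?polyXsubC_eq0 // size_XsubC sw.
by split.
Qed.

Lemma bin_rat (k b : nat) : ('C(k + b, k))%:R = ((k + b)`!)%:R / (k`! * b`!)%:R :> rat.
Proof.
apply: (canRL (mulfK _)); first by rewrite natrM mulf_neq0 ?natr_fact_neq0.
by rewrite -natrM -(@bin_fact (k + b) k) ?leq_addr // addKn.
Qed.

(** Both binomials are multiples of N! / (a! (N+1-a)!), by N+1-a and by a, which turns their
    combination into one entry times a linear factor. *)
Lemma bin_sum_succ (N a : nat) (c d : rat) :
  c * 'C(N, a)%:R + d * (if a is a'.+1 then 'C(N, a')%:R else 0) =
  if (a <= N.+1)%N then
    (c * (N.+1 - a)%:R + d * a%:R) * (N`!)%:R / (a`! * (N.+1 - a)`!)%:R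
  else 0.
Proof.
case: a => [|a].
  rewrite bin0 subn0 fact0 mul1n leq0n factS natrM.
  by field; rewrite natr_fact_neq0 nat1r Num.Theory.pnatr_eq0.
rewrite ltnS subSS; case: leqP => [aN|Na]; last first.
  by rewrite !bin_small ?mulr0 ?addr0 // ltnW.
rewrite -(subnKC aN); move: (N - a)%N => b; rewrite addKn bin_rat.
case: b => [|b].
  rewrite addn0 bin_small // fact0 !muln1 factS natrM.
  by field; rewrite natr_fact_neq0 nat1r Num.Theory.pnatr_eq0.
rewrite addnS -addSn bin_rat addSn !factS !natrM.
by field; rewrite !natr_fact_neq0 !nat1r !Num.Theory.pnatr_eq0.
Qed.

Lemma wn_coef (p : {poly rat}) k m t : ((1 - 'X) ^+ k * (p * w ^+ m))`_t =
  (-1) ^+ m * (if (t < m)%N then 0 else (p * (1 - 'X) ^+ (m + k))`_(t - m)).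
Proof.
have wm : w ^+ m = (-1) ^+ m *: ('X^m * (1 - 'X) ^+ m).
  rewrite -exprMn (_ : w = - ('X * (1 - 'X))); last by rewrite /w; ring.
  by rewrite -scaleN1r exprZn.
rewrite (_ : _ * _ = (-1) ^+ m *: ('X^m * (p * (1 - 'X) ^+ (m + k)))); last first.
  by rewrite wm -!scalerAr exprD; congr (_ *: _); ring.
by rewrite coefZ coefXnM.
Qed.

Lemma pairing_even x l k :
  pairing (row_poly x (2 * l)) (col_poly (2 * k)) (2 * x + 1) =
  (2 * x + 2 + 3 * k)%:R * mrr_entry 1 (x + 2) l k.
Proof.
rewrite /row_poly /col_poly !(mul2n l, mul2n k) uphalf_double !odd_double doubleK /= expr1.
rewrite expr0 mul1r pairing_wn.
rewrite wn_coef /mrr_entry.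
have -> : (2 * x + 1 + 2 * k < x + l)%N = ~~ (l < x + 2 + 2 * k)%N by lia.
case: ltnP => /= h; last by rewrite andbF !mulr0.
have [a ea] : exists a, (a + l = x + 1 + 2 * k)%N by exists (x + 1 + 2 * k - l)%N; lia.
have -> : (2 * x + 1 + 2 * k - (x + l) = a)%N by lia.
have -> : (x + 2 + 2 * k - l - 1 = a)%N by lia.
rewrite /v mulrBl mulrDl mul1r coefB coefD coefXM coef_1subXn.
have sgn : (-1) ^+ (x + l) * (-1) ^+ a.+1 = 1 :> rat.
  by rewrite -exprD -signr_odd (_ : odd _ = false) //; lia.
transitivity ('C(x + l + k, a)%:R + 2 * (if a is a'.+1 then 'C(x + l + k, a')%:R else 0) : rat).
  rewrite -[RHS]mul1r -[X in _ = X * _]sgn; case: a {ea h sgn} => [|a] /=; rewrite ?coef_1subXn !exprS; ring.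
rewrite -[X in X + _]mul1r bin_sum_succ.
have -> : (a <= (x + l + k).+1)%N = (k < 1 + 2 * l)%N by lia.
rewrite andbT; case: ltnP => hk; last by rewrite mulr0.
rewrite mulrA; congr (_ * _%:R / _).
(* The linear factor (2l - k) + 2 (x + 1 + 2k - l) = 2x + 2 + 3k is free of l, so it can be taken
   out of the column. *)
- by rewrite mul1r -natrM -natrD; congr _%:R; lia.
- by congr (_`!); lia.
- by rewrite mulnC; congr (_`! * _`!)%:R; lia.
Qed.

Lemma pairing_odd x l k :
  pairing (row_poly x (2 * l).+1) (col_poly (2 * k).+1) (2 * x + 1) =
  (x + 3 + 3 * l)%:R * mrr_entry 2 (x + 2) l k.
Proof.
rewrite /row_poly /col_poly !(mul2n l, mul2n k) /= uphalf_double !odd_double /= doubleK expr1.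
rewrite expr0 mul1r pairing_vwn wn_coef /mrr_entry.
have -> : ((2 * x + 1).+1 + 2 * k < x + l.+1)%N = ~~ (l < x + 2 + 2 * k)%N by lia.
case: ltnP => /= h; last by rewrite andbF !mulr0.
have [a ea] : exists a, (a + l = x + 1 + 2 * k)%N by exists (x + 1 + 2 * k - l)%N; lia.
have -> : ((2 * x + 1).+1 + 2 * k - (x + l.+1) = a)%N by lia.
have -> : (x + 2 + 2 * k - l - 1 = a)%N by lia.
rewrite mulrBl mulrDl mul1r coefB coefD coefXM coef_1subXn.
have sgn : (-1) ^+ (x + l.+1) * (-1) ^+ a = 1 :> rat.
  by rewrite -exprD -signr_odd (_ : odd _ = false) //; lia.
transitivity (2 * 'C(x + l.+1 + k, a)%:R + 1 * (if a is a'.+1 then 'C(x + l.+1 + k, a')%:R else 0) : rat).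
  rewrite -[RHS]mul1r -[X in _ = X * _]sgn; case: a {ea h sgn} => [|a] /=; rewrite ?coef_1subXn ?exprS; ring.
rewrite bin_sum_succ.
have -> : (a <= (x + l.+1 + k).+1)%N = (k < 2 + 2 * l)%N by lia.
rewrite andbT; case: ltnP => hk; last by rewrite mulr0.
rewrite mulrA; congr (_ * _%:R / _).
(* Now 2 (2l + 1 - k) + (x + 1 + 2k - l) = x + 3 + 3l is free of k and comes out of the row. *)
- by rewrite mul1r -natrM -natrD; congr _%:R; lia.
- by congr (_`!); lia.
- by rewrite mulnC; congr (_`! * _`!)%:R; lia.
Qed.

Lemma size_row_poly x r : size (row_poly x r) = (2 * x + 1 + r).+1.
Proof.
rewrite (size_lead_vw _ _).1; congr _.+1; have := odd_double_half r.
by rewrite uphalf_half; case: (odd r) => /=; lia.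
Qed.

Lemma size_col_poly c : size (col_poly c) = c.+1.
Proof.
by rewrite (size_lead_vw _ _).1; congr _.+1; rewrite -[RHS]odd_double_half -mul2n.
Qed.

(* The matrix is 1 + A B for the involutions A_ij = (-1)^j C(i + m, j + m) and
   B_ij = (-1)^i C(j, i), m = 2 x + 1, which are both the substitution
   X := 1 - X.  The rows of F and the columns of E are eigenvectors of A and B. *)
Lemma det_binomial_pairing n x :
  \det (\matrix_(i < n, j < n) ((i == j)%:R + 'C(2 * x + 1 + i + j, i)%:R)) =
  \det (\matrix_(r < n, c < n) if odd r == odd c then
     pairing (row_poly x r) (col_poly c) (2 * x + 1) else 0).
Proof.
set M := (X in \det X = _); set G := (X in _ = \det X).
pose m := (2 * x + 1)%N.
pose F : 'M[rat]_n := \matrix_(r, i) (row_poly x r)`_(i + m).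
pose E : 'M[rat]_n := \matrix_(j, c) (col_poly c)`_j.
pose A : 'M[rat]_n := \matrix_(i, j) ((-1) ^+ j * 'C(i + m, j + m)%:R).
pose B : 'M[rat]_n := \matrix_(i, j) ((-1) ^+ i * 'C(j, i)%:R).
have MAB : M = 1%:M + A *m B.
  apply/matrixP => i j; rewrite !mxE; congr (_ + _).
  rewrite (_ : 2 * x + 1 + i + j = i + m + j)%N; last by rewrite /m; lia.
  (* The factor C(i + m, i - t) equals C(i + m, t + m), and the signs of A and B cancel. *)
  rewrite [(i + m + j)%N]addnC -binomial.Vandermonde natr_sum.
  rewrite (big_ord_widen n (fun t => ('C(j, t) * 'C(i + m, i - t))%:R)) //.
  rewrite [RHS](bigID (fun t : 'I_n => (t < i.+1)%N)) /= [X in _ = _ + X]big1 ?addr0.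
    apply: eq_bigr => t ti; rewrite !mxE mulrCA !mulrA -expr2 sqrr_sign mul1r.
    rewrite -natrM mulnC; congr ((_ * _)%:R).
    by rewrite -[RHS]bin_sub; [congr 'C(_, _); lia | lia].
  by move=> t; rewrite -leqNgt => ti; rewrite !mxE bin_small ?mulr0 ?mul0r //; lia.
have FA : F *m A = \matrix_(r, j) ((-1) ^+ r * F r j).
  apply/matrixP => r j; rewrite !mxE.
  have sp : (size (row_poly x r) <= m + n)%N.
    by rewrite size_row_poly /m; have := ltn_ord r; lia.
  have := coef_comp_1subX (j + m) sp; rewrite vw_comp -/(row_poly x r) big_split_ord /=.
  rewrite big1 ?add0r => [|i _]; last first.
    by rewrite bin_small ?mulr0 //; have := ltn_ord i; lia.
  (* A has the sign (-1)^j where the substitution has (-1)^(j + m), and m is odd; this turns the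
     eigenvalue (-1)^(r+1) into (-1)^r. *)
  move=> h; transitivity (- ((-1) ^+ (~~ odd r) * row_poly x r)`_(j + m)).
    rewrite h -sumrN; apply: eq_bigr => i _; rewrite !mxE (addnC m) exprD.
    rewrite (_ : (-1) ^+ m = -1) ?mulrN1 ?mulNr ?mulrN ?opprK //.
    by rewrite -signr_odd /m oddD oddM.
  by rewrite -[in RHS]signr_odd !mulr_sign; case: (odd r); rewrite /= ?coefN ?opprK.
have BE : B *m E = \matrix_(i, c) ((-1) ^+ c * E i c).
  apply/matrixP => i c; rewrite !mxE.
  have sp : (size (col_poly c) <= n)%N by rewrite size_col_poly.
  have := coef_comp_1subX i sp; rewrite vw_comp -/(col_poly c) => h.
  transitivity (((-1) ^+ (odd c) * col_poly c)`_i).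
    by rewrite h; apply: eq_bigr => j _; rewrite !mxE mulrC.
  by rewrite -[in RHS]signr_odd !mulr_sign; case: (odd c); rewrite /= ?coefN.
have FE r c : (F *m E) r c = pairing (row_poly x r) (col_poly c) m.
  rewrite mxE (@pairingE _ _ _ n) ?size_col_poly //.
  by apply: eq_bigr => i _; rewrite !mxE.
have FME : F *m M *m E = 2%:R *: G.
  rewrite MAB mulmxDr mulmx1 mulmxDl -!mulmxA BE mulmxA FA.
  apply/matrixP => r c; rewrite [LHS]mxE FE [X in _ + X]mxE.
  transitivity (pairing (row_poly x r) (col_poly c) m
      + (-1) ^+ r * (-1) ^+ c * pairing (row_poly x r) (col_poly c) m).
    rewrite -FE [in X in _ = _ + X]mxE big_distrr; congr (_ + _).
    by apply: eq_bigr => j _; rewrite !mxE /=; ring.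
  rewrite !mxE -[_ ^+ r]signr_odd -[_ ^+ c]signr_odd !mulr_sign.
  by case: (odd r); case: (odd c); rewrite /= ?mulr_sign /=; ring.
have dFE : \det F * \det E = 2%:R ^+ n.
  rewrite -(det_tr E) !det_trig; try apply/is_trig_mxP => i j ij.
  - rewrite -big_split /= -[in RHS](card_ord n) -prodr_const; apply: eq_bigr => i _.
    rewrite !mxE; transitivity (lead_coef (row_poly x i) * lead_coef (col_poly i)).
      by rewrite /lead_coef size_row_poly size_col_poly /= addnC.
    by rewrite !(size_lead_vw _ _).2 -exprD addn_negb.
  - by rewrite !mxE nth_default // size_row_poly -/m; lia.
  - by rewrite !mxE nth_default // size_col_poly.
have : 2%:R ^+ n * \det M = 2%:R ^+ n * \det G.
  by rewrite -[RHS]detZ -FME -dFE !det_mulmx; ring.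
by apply: mulfI; rewrite expf_neq0.
Qed.

Lemma det_binomial n x :
  \det (\matrix_(i < n, j < n) ((i == j)%:R + 'C(2 * x + 1 + i + j, i)%:R)) =
  (\prod_(k < uphalf n) (2 * x + 2 + 3 * k)%:R) * mrr_prod (uphalf n) 0 x.+1
  * ((\prod_(l < n./2) (x + 3 + 3 * l)%:R) * mrr_prod n./2 1 x.+1).
Proof.
rewrite det_binomial_pairing.
rewrite (det_checkerboard n (fun r c => pairing (row_poly x r) (col_poly c) (2 * x + 1))).
rewrite (eq_minor_det _ (pairing_even x)) (eq_minor_det _ (pairing_odd x)).
rewrite (minor_det_scale_col _ (fun k => (2 * x + 2 + 3 * k)%:R)).
rewrite (minor_det_scale_row _ (fun l => (x + 3 + 3 * l)%:R)).
by rewrite !addn2 !mrr_det.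
Qed.

End Pairing.

(** * Comparison with the product formula *)

Section Product.

Local Open Scope ring_scope.

Lemma prod_factS a k :
  (\prod_(i < k) ((a + 1 + i)`!)%:R) * (a`!)%:R
    = (\prod_(i < k) ((a + i)`!)%:R) * ((a + k)`!)%:R :> rat.
Proof.
elim: k => [|k IH]; first by rewrite !big_ord0 addn0.
rewrite !big_ord_recr /= mulrAC IH.
by congr (_ * _`!%:R); lia.
Qed.

Lemma prod_fact_neq0 a k : \prod_(i < k) ((a + i)`!)%:R != 0 :> rat.
Proof. by apply/prodf_neq0 => i _; apply: natr_fact_neq0. Qed.

Lemma risingSr a k : rising a k.+1 = (rising a k * (a + k))%N.
Proof. by rewrite /rising big_ord_recr. Qed.

Let W (x m : nat) : rat := \prod_(i < m)
  ((i`! ^ 2 * rising (2 * x + 2 * i + 2) i.+1 ^ 2 * (x + i)`!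
        * rising (x + 2 * i + 1) i)%:R / ((2 * i)`! ^ 2)%:R).

Let U (x m : nat) : rat := \prod_(i < m) (rising (x + 2 * i) i.+1)%:R.
Let V (a k : nat) : rat := \prod_(i < k) ((a + i)`!)%:R.

Lemma P_even_valueE m x : P_even_value m x =
  (m`! * x.-1`!)%:R / ((2 * m)`!)%:R * (U x m.+1 / V (x + m) m.+1) * W x m.
Proof. by rewrite /P_even_value /U /V -prodf_div. Qed.

(** From P_{2m} to P_{2m+2} both parity blocks grow by one, and each contributes one factor. *)
Lemma P_even_value_rec m x : P_even_value m.+1 x = P_even_value m x *
  ((2 * x + 2 + 3 * m)%:R * mrr_factor 0 x.+1 m *
   ((x + 3 + 3 * m)%:R * mrr_factor 1 x.+1 m)).
Proof.
rewrite !P_even_valueE.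
have -> : U x m.+2 = U x m.+1 * (rising (x + 2 * m.+1) m.+2)%:R.
  by rewrite /U big_ord_recr.
rewrite [W x m.+1]big_ord_recr /= -/(W x m).
(* The factorials in the denominator form a window starting at x + m: one drops out and two
   enter. *)
have eV : V (x + m.+1) m.+2 * ((x + m)`!)%:R =
    V (x + m) m.+1 * ((x + 2 * m + 1)`!)%:R * ((x + 2 * m + 2)`!)%:R.
  rewrite /V big_ord_recr /= mulrAC (_ : x + m.+1 = x + m + 1)%N; last by lia.
  by rewrite prod_factS; congr (_ * _`!%:R * _`!%:R); lia.
have V0 := prod_fact_neq0 (x + m) m.+1; rewrite -/(V _ _) in V0.
have -> : V (x + m.+1) m.+2 = V (x + m) m.+1 * ((x + 2 * m + 1)`!)%:R
    * ((x + 2 * m + 2)`!)%:R / ((x + m)`!)%:R.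
  by rewrite -eV mulfK ?natr_fact_neq0.
rewrite /mrr_factor.
have -> : (0 + x.+1 + m - 1 = x + m)%N by lia.
have -> : (1 + x.+1 + m - 1 = (x + m).+1)%N by lia.
have -> : (2 * 0 + x.+1 + 2 * m = x + 2 * m + 1)%N by lia.
have -> : (2 * 1 + x.+1 + 2 * m = x + 2 * m + 3)%N by lia.
have -> : (0 + 2 * x.+1 + 2 * m = 2 * x + 2 * m + 2)%N by lia.
have -> : (1 + 2 * x.+1 + 2 * m = (2 * x + 2 * m + 2).+1)%N by lia.
have -> : (0 + 2 * m = 2 * m)%N by lia.
have -> : (1 + 2 * m = (2 * m).+1)%N by lia.
have -> : (2 * m.+1 = (2 * m).+2)%N by lia.
have -> : (x + 2 * m + 2 = (x + 2 * m + 1).+1)%N by lia.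
have -> : (x + (2 * m).+2 = (x + 2 * m + 1).+1)%N by lia.
have e2 : ((x + 3 + 3 * m)%:R * (rising (x + 2 * m + 3) m)%:R =
    (rising (x + 2 * m + 3) m.+1)%:R :> rat).
  by rewrite risingSr natrM mulrC; congr (_ * _%:R); lia.
have e3 : (rising (x + 2 * m + 1).+1 m.+2)%:R =
    (x + 2 * m + 1).+1%:R * (rising (x + 2 * m + 3) m.+1)%:R :> rat.
  by rewrite risingS natrM; congr (_ * (rising _ _)%:R); lia.
rewrite e3 -e2.
set A := (2 * x + 2 * m + 2)%N.
have -> : (rising A m.+1 ^ 2 = rising A m * (A + m) * (A * rising A.+1 m))%N.
  by rewrite -risingS -risingSr.
move: (U x m.+1) (W x m) (V (x + m) m.+1) V0 => u ww v0 v0_neq0.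
rewrite !factS !expnS !expn0 !muln1 !natrM /A -?natr1 !natrD ?natrM.
by field; rewrite !natr_fact_neq0 v0_neq0 -!natrD !natr1 !Num.Theory.pnatr_eq0.
Qed.

Let Z (x i : nat) : rat := (i`! ^ 2 * (x + i)`! * rising (x + 2 * i + 1) i)%:R
  / ((2 * i)`! ^ 2)%:R.

(** The squared factor number i + 1 of the odd formula is number i of the even one. *)
Lemma prod_odd_even x m :
  \prod_(i < m.+1) (Z x i * (rising (2 * x + 2 * i) i ^ 2)%:R) = W x m * Z x m.
Proof.
elim: m => [|m IH]; first by rewrite big_ord_recr /W !big_ord0 /= rising0 exp1n mulr1.
rewrite big_ord_recr /= IH /W [X in _ = X * _]big_ord_recr /= -/(W x m).
rewrite (_ : 2 * x + 2 * m.+1 = 2 * x + 2 * m + 2)%N; last by lia.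
by rewrite [Z x m]/Z !natrM; ring.
Qed.

Lemma P_odd_value_rec m x : P_odd_value m.+1 x = P_even_value m x *
  ((2 * x + 2 + 3 * m)%:R * mrr_factor 0 x.+1 m).
Proof.
have -> : P_odd_value m.+1 x = (x.-1`! * rising (2 * x + 2 * m.+1) m.+1)%:R
    / ((x + m)`!)%:R * (U x m.+1 / V (x + m + 1) m.+1 * (W x m * Z x m)).
  rewrite -prod_odd_even /U /V -prodf_div -big_split /P_odd_value.
  congr (_ / _`!%:R * _); first by lia.
  apply: eq_bigr => i _ /=; rewrite /Z (_ : x + m.+1 + i = x + m + 1 + i)%N; last by lia.
  by rewrite !natrM !invfM; ring.
have V0 := prod_fact_neq0 (x + m) m.+1; rewrite -/(V _ _) in V0.
have -> : V (x + m + 1) m.+1 = V (x + m) m.+1 * ((x + 2 * m + 1)`!)%:R / ((x + m)`!)%:R.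
  apply: (canRL (mulfK _)); rewrite ?natr_fact_neq0 // /V prod_factS.
  by congr (_ * _`!%:R); lia.
rewrite P_even_valueE /mrr_factor /Z.
have -> : (0 + x.+1 + m - 1 = x + m)%N by lia.
have -> : (2 * 0 + x.+1 + 2 * m = x + 2 * m + 1)%N by lia.
have -> : (0 + 2 * x.+1 + 2 * m = 2 * x + 2 * m + 2)%N by lia.
have -> : (2 * x + 2 * m.+1 = 2 * x + 2 * m + 2)%N by lia.
have -> : (0 + 2 * m = 2 * m)%N by lia.
move: (U x m.+1) (W x m) (V (x + m) m.+1) V0 => u ww v0 v0_neq0.
rewrite !risingSr !expnS !expn0 !muln1 !natrM ?natrD ?natrM.
by field; rewrite !natr_fact_neq0 v0_neq0.
Qed.

Lemma P_valueE n x : (0 < x)%N -> P_value n x =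
  (\prod_(k < uphalf n) (2 * x + 2 + 3 * k)%:R) * mrr_prod (uphalf n) 0 x.+1
  * ((\prod_(l < n./2) (x + 3 + 3 * l)%:R) * mrr_prod n./2 1 x.+1).
Proof.
move=> x0; pose S (a b : nat) : rat :=
  (\prod_(k < a) (2 * x + 2 + 3 * k)%:R) * mrr_prod a 0 x.+1
  * ((\prod_(l < b) (x + 3 + 3 * l)%:R) * mrr_prod b 1 x.+1).
have Sl a b : S a.+1 b = S a b * ((2 * x + 2 + 3 * a)%:R * mrr_factor 0 x.+1 a).
  by rewrite /S mrr_prodS big_ord_recr /=; ring.
have Sr a b : S a b.+1 = S a b * ((x + 3 + 3 * b)%:R * mrr_factor 1 x.+1 b).
  by rewrite /S mrr_prodS big_ord_recr /=; ring.
have E m : P_even_value m x = S m m.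
  elim: m => [|m IH]; last by rewrite P_even_value_rec IH Sl Sr; ring.
  rewrite P_even_valueE /U /V /W /S /mrr_prod !big_ord_recr !big_ord0 /=.
  rewrite !muln0 !addn0 risingS rising0 muln1 fact0 mul1n.
  (* Here x > 0 matters: the value (x-1)! x / x! is then 1. *)
  case: x x0 {S Sl Sr} => // y _; rewrite factS natrM.
  by field; rewrite /= natr_fact_neq0 nat1r Num.Theory.pnatr_eq0.
rewrite -/(S (uphalf n) n./2) /P_value; case: ifP => on.
  have -> : uphalf n = (n./2).+1 by rewrite uphalf_half on.
  by rewrite P_odd_value_rec E Sl.
by rewrite E uphalf_half on.
Qed.

End Product.

(** * From values to polynomials *)

Section Polynomials.

Local Open Scope ring_scope.

Lemma poly_eq_nat (p q : {poly rat}) :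
  (forall x : nat, (0 < x)%N -> p.[x%:R] = q.[x%:R]) -> p = q.
Proof.
move=> pq; apply/eqP; rewrite -subr_eq0; apply: contraT => nz.
pose rs := [seq (i.+1)%:R : rat | i <- iota 0 (size (p - q)%R)].
have := max_poly_roots (rs := rs) nz; rewrite size_map size_iota ltnn => -> //.
  apply/allP => _ /mapP[i _ ->].
  by rewrite rootE hornerD hornerN pq // subrr.
rewrite map_inj_uniq ?iota_uniq // => i j /eqP.
by rewrite Num.Theory.eqr_nat eqSS => /eqP.
Qed.

Definition binomial_poly (i j : nat) : {poly rat} :=
  (i`!%:R)^-1 *: \prod_(t < i) ('X + ((i + j - t)%:R)%:P).

Lemma horner_binomial_poly i j x : (binomial_poly i j).[x%:R] = 'C(x + i + j, i)%:R.
Proof.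
rewrite hornerZ horner_prod; apply: (canLR (mulKf _)); first exact: natr_fact_neq0.
rewrite -natrM mulnC bin_ffact ffact_prod natr_prod; apply: eq_bigr => t _.
by rewrite !hornerE -natrD; congr (_%:R); have := ltn_ord t; lia.
Qed.

Definition tiling_poly (n : nat) : {poly rat} :=
  \det (\matrix_(i < n, j < n) ((i == j)%:R + binomial_poly i j)).

Lemma horner_tiling_poly n x : (tiling_poly n).[x%:R] =
  \det (\matrix_(i < n, j < n) ((i == j)%:R + 'C(x + i + j, i)%:R)).
Proof.
rewrite -[LHS]/(horner_eval x%:R _) -det_map_mx; congr (\det _).
apply/matrixP => i j; rewrite !mxE /= /horner_eval hornerD horner_binomial_poly.
by congr (_ + _); case: (i == j); rewrite hornerE.
Qed.

(** The determinant witnesses existence, so [xget] does not return its default. *)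
Lemma CS_tiling_poly n : (0 < n)%N -> CS n = tiling_poly n.
Proof.
move=> n0; apply: poly_eq_nat => x _; rewrite horner_tiling_poly -num_cs_tilings_det //.
apply: (@classical_sets.xgetPex _ 1 (fun p : {poly rat} =>
  forall x : nat, p.[x%:R] = (num_cs_tilings n x)%:R)).
by exists (tiling_poly n) => y; rewrite horner_tiling_poly num_cs_tilings_det.
Qed.

(** The witness for [xget] is the determinant at 2X + 1, whose values were shown to be the
    products. *)
Lemma P_tiling_poly n : P n = tiling_poly n \Po ('X + 'X + 1).
Proof.
have e x : (0 < x)%N -> (tiling_poly n \Po ('X + 'X + 1)).[x%:R] = P_value n x.
  move=> x0; rewrite horner_comp !hornerE -natrD natr1 -addn1 addnn -mul2n.
  by rewrite horner_tiling_poly det_binomial -P_valueE.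
apply: poly_eq_nat => x x0; rewrite e //; move: x x0.
apply: (@classical_sets.xgetPex _ 0 (fun p : {poly rat} =>
  forall x : nat, (1 <= x)%N -> p.[x%:R] = P_value n x)).
by exists (tiling_poly n \Po ('X + 'X + 1)).
Qed.

End Polynomials.

Local Open Scope ring_scope.

Theorem corollary3p3 (n : nat) (hn : (1 <= n)%N) :
  CS n = P n \Po (2%:R^-1 *: ('X - 1)).
Proof.
rewrite CS_tiling_poly // P_tiling_poly -comp_polyA; apply/esym.
rewrite -[RHS]comp_polyXr; congr (_ \Po _).
rewrite !comp_polyD comp_polyX rmorph1 -mulr2n -scaler_nat scalerA divff //.
by rewrite scale1r subrK.
Qed.
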